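(* Let $p\in(0,1)$ and let $\mu^+,\mu^-$ be two finite measures with finite supports on the Euclidean plane $\mathbb{R}^2$ with $\mu^+(\mathbb{R}^2)=\mu^-(\mathbb{R}^2)$. Let a $(\mu^+,\mu^-)$-flow be a solution of the Gilbert--Steiner problem, i.e. a $(\mu^+,\mu^-)$-flow which minimizes, among all $(\mu^+,\mu^-)$-flows in $\mathbb{R}^2$, the Gilbert functional with cost function $C(x)=x^p$. Then this flow has no branching point of degree at least $4$.
   Context: Let $\mu^+,\mu^-$ be two finite measures with finite supports on $\mathbb{R}^2$ (with Euclidean distance $\rho$) and equal total masses. A $(\mu^+,\mu^-)$-flow consists of: a finite set $V\subset\mathbb{R}^2$ (vertices) containing the support of the signed measure $\mu^+-\mu^-$; a finite collection $E$ of unordered pairs $\{x,y\}\subset V$, $x\neq y$ (edges), so that $(V,E)$ is a finite simple undirected graph; and, for every $\{x,y\}\in E$, two non-zero real numbers $m(x,y)$ and $m(y,x)$ with $m(x,y)+m(y,x)=0$, such that $$\mu^+-\mu^-=\sum_{\{x,y\}\in E} m(x,y)\,(\delta_y-\delta_x),$$ where $\delta_x$ is the delta-measure at $x$. (The vertex set $V$ is part of the data of the flow and may vary between flows.) Given a cost function $C\colon[0,\infty)\to[0,\infty)$, the Gilbert functional of the flow is $\sum_{\{x,y\}\in E} C(|m(x,y)|)\,\rho(x,y)$. A branching point of the flow is a vertex in $V\setminus(\operatorname{supp}(\mu^+)\cup\operatorname{supp}(\mu^-))$. Its degree is its degree in the graph $(V,E)$. *)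

(* Defs.v *)
From HB Require Import structures.
From mathcomp Require Import all_boot all_order all_algebra finmap.
From mathcomp Require Import all_classical all_reals all_analysis.
From mathcomp Require Import measurable_realfun.

Set Implicit Arguments.
Unset Strict Implicit.
Unset Printing Implicit Defensive.

Import Order.TTheory GRing.Theory Num.Theory.
Import numFieldNormedType.Exports.

Local Open Scope classical_set_scope.
Local Open Scope ring_scope.

(* R * R carries the library's product topology and product sigma-algebra,
   i.e. the usual topology and Borel sets of the plane. Its canonical norm is
   the sup norm, hence the explicit Euclidean distance [rho]. *)
Notation plane R := (R * R)%type.

Definition rho (R : realType) (x y : plane R) : R :=
  Num.sqrt ((x.1 - y.1) ^+ 2 + (x.2 - y.2) ^+ 2).

(* Support of a finite signed measure, i.e. of its total variation: an open set
   is null for the total variation iff all its measurable subsets are null for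
   nu. For a (nonnegative) measure this is the usual support, by monotonicity:
   see supp_measureE. *)
Definition supp (R : realType) (nu : set (plane R) -> \bar R) : set (plane R) :=
  [set x | forall U : set (plane R), open U -> U x ->
     exists A, [/\ measurable A, A `<=` U & nu A != 0%E]].

Lemma open_measurable_plane (R : realType) (U : set (plane R)) :
  open U -> measurable U.
Proof.
move=> oU.
pose B (i : rat * rat * nat) : set (plane R) :=
  ball (ratr i.1.1 : R) i.2.+1%:R^-1 `*` ball (ratr i.1.2 : R) i.2.+1%:R^-1.
pose D : set (rat * rat * nat) := [set i | B i `<=` U].
have -> : U = \bigcup_(i in D) B i.
  apply/seteqP; split => [[x y] Uxy|z [i Di Biz]]; last exact: Di.
  have /nbhs_ballP[e /= e0 eU] : nbhs (x, y) U by exact: open_nbhs_nbhs.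
  have /ltr_add_invr[n] : 0 < e / 2 by rewrite divr_gt0.
  rewrite add0r => ne.
  have n0 : 0 < n.+1%:R^-1 :> R by rewrite invr_gt0.
  have dn (a : R) : exists q : rat, ball (ratr q : R) n.+1%:R^-1 a.
    have [] := @dense_rat R (ball a n.+1%:R^-1).
    - by exists a; exact: ballxx.
    - exact: ball_open.
    by move=> b [/ball_sym bq [q _ qb]]; exists q; rewrite qb.
  have [p px] := dn x; have [q qy] := dn y.
  have sub (r a b : R) : ball r n.+1%:R^-1 a -> ball r n.+1%:R^-1 b -> ball a e b.
    move=> /(le_ball (ltW ne)) ra /(le_ball (ltW ne)) rb.
    by rewrite (splitr e); apply: ball_triangle rb; exact: ball_sym.
  exists (p, q, n) => //= -[a b] [/= pa qb]; apply: eU; split => /=.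
    exact: sub pa.
  exact: sub qb.
have mB i : measurable (B i).
  by apply: measurableX; apply: open_measurable; exact: ball_open.
rewrite bigcup_mkcond; apply: countable_bigcupT_measurable => [|i].
  exact: countableP.
by case: ifP.
Qed.

Lemma supp_measureE (R : realType) (mu : {measure set (plane R) -> \bar R}) :
  supp mu = [set x | forall U : set (plane R), open U -> U x -> (0 < mu U)%E].
Proof.
apply/seteqP; split => x /= Hx U oU Ux; have mU := open_measurable_plane oU.
  have [A [mA AU A0]] := Hx U oU Ux.
  apply: (@lt_le_trans _ _ (mu A)); first by rewrite lt0e A0 measure_ge0.
  by rewrite le_measure ?inE.
by exists U; split => //; rewrite gt_eqF ?Hx.
Qed.

(* Sum over unordered pairs e = {x, y} of f x y. The elements of e are listed in
   an arbitrary order, which is harmless for the symmetric f used below: see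
   edge_valE. *)
Definition edge_val (R : realType) (Z : Type) (f : plane R -> plane R -> Z)
    (e : {fset plane R}) : Z :=
  f (nth 0 (enum_fset e) 0) (nth 0 (enum_fset e) 1).

Definition edge_sum (R : realType) (Z : nmodType) (E : {fset {fset plane R}})
    (f : plane R -> plane R -> Z) : Z :=
  \sum_(e <- E) edge_val f e.

Lemma edge_valE (R : realType) (Z : Type) (f : plane R -> plane R -> Z)
    (x y : plane R) :
  x != y -> f x y = f y x -> edge_val f [fset x; y]%fset = f x y.
Proof.
move=> xy fxy; rewrite /edge_val.
have xyE : enum_fset [fset x; y]%fset =i [:: x; y].
  by move=> z; rewrite -[LHS]/(z \in [fset x; y]%fset) !inE.
have uxy : uniq [:: x; y] by rewrite /= inE xy.
have us : uniq (enum_fset [fset x; y]%fset) by exact: fset_uniq.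
have := uniq_size_uniq uxy (fun z => esym (xyE z)); rewrite us => /esym/eqP.
case: (enum_fset _) us xyE => [|a [|b [|c s]]] //= + xyE _.
rewrite inE andbT; have := xyE a; have := xyE b; rewrite !inE !eqxx orbT /=.
by move=> /esym/orP[]/eqP-> /esym/orP[]/eqP->; rewrite ?eqxx.
Qed.

(* The values of [flow_mass] outside the edges are irrelevant. *)
Record flow (R : realType)
    (mup mum : {finite_measure set (plane R) -> \bar R}) := Flow {
  flow_vertices : {fset plane R} ;
  flow_edges : {fset {fset plane R}} ;
  flow_mass : plane R -> plane R -> R ;
  flow_supp : supp (mup \- mum)%E `<=` [set` flow_vertices] ;
  flow_edgesP : forall e, e \in flow_edges ->
    exists x y, [/\ x \in flow_vertices, y \in flow_vertices, x != y
                  & e = [fset x; y]%fset] ;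
  flow_mass_neq0 : forall x y, [fset x; y]%fset \in flow_edges ->
    flow_mass x y != 0 ;
  flow_massC : forall x y, [fset x; y]%fset \in flow_edges ->
    flow_mass x y + flow_mass y x = 0 ;
  flow_balance : forall A, measurable A ->
    (mup A - mum A)%E =
    edge_sum flow_edges
      (fun x y => (flow_mass x y)%:E * (\d_y A - \d_x A))%E
}.

Definition gilbert (R : realType)
    (mup mum : {finite_measure set (plane R) -> \bar R})
    (C : R -> R) (F : flow mup mum) : R :=
  edge_sum (flow_edges F) (fun x y => C `|flow_mass F x y| * rho x y).

Definition branching_point (R : realType)
    (mup mum : {finite_measure set (plane R) -> \bar R})
    (F : flow mup mum) (v : plane R) : Prop :=
  v \in flow_vertices F /\ ~ (supp mup `|` supp mum) v.

Definition degree (R : realType)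
    (mup mum : {finite_measure set (plane R) -> \bar R})
    (F : flow mup mum) (v : plane R) : nat :=
  #|` [fset e in flow_edges F | v \in e]%fset|.

(* Main.v *)
Require Import Defs.
From mathcomp Require Import all_boot all_order all_algebra finmap.
From mathcomp Require Import all_classical all_reals all_analysis.
From mathcomp Require Import ring lra.

(** Why branching points have degree at most 3.

    Let v be a branching point with neighbours x_i, let m_i be the mass sent
    from v to x_i and let z_i be the vector of length |m_i|^p that points from
    v to x_i. Since v carries no mass, the m_i sum to 0. Splitting a set D of
    edges off from v to a new vertex w close to v, joined to v by an edge
    carrying the sum of the masses in D, gives a competing flow
    ([split_flow]); to first order its cost is not smaller only if
      |sum of z_i over D| <= |sum of m_i over D|^p        for every D
    ([first_variation]). In particular the z_i sum to 0. The rest is about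
    such vectors in the plane: there are at most three
    ([balanced_star_card_le3]).

    Order the edges by the angle of z_i and let s_0 = 0, s_1, ... be the
    partial sums of the masses in this order. The function |x|^(2p) is of
    conditionally negative type because 2p < 2, so there are points W(x) of a
    Hilbert space with |W(x) - W(y)| = |x - y|^p (a fractional Brownian
    motion). The closed polygon with vertices W(s_k) has the side lengths
    |m_i|^p of the planar convex polygon with sides z_i, and the inequality
    for two consecutive edges says that its exterior angles are not larger.
    The exterior angles of the planar polygon add up to 2 pi, while by
    Fenchel's theorem those of any closed polygon add up to at least 2 pi, so
    that there is equality. In the equality case three sides of the Hilbert
    polygon are linearly dependent, which the strict negative type of
    |x|^(2p), together with the inequality above, only allows for a triangle.

    Fenchel's argument is used in this form: fix a side, follow the curve of
    unit tangents for half its length on each side until it comes to a point g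
    of the arc between two consecutive tangents e_a and e_b. By the triangle
    inequality on the sphere every unit tangent e has nonnegative inner product
    with e_o + g. A positive combination of the tangents vanishes, so these
    inner products are all 0, hence e_o + g = 0 ([closed_polygon_isotropic]).
    This relates three sides only. Comparing the endpoints of these sides, and
    using the inequality above for the arcs between them, leaves no room for a
    fourth edge ([polar_contradiction]).

    No Hilbert space is built: vectors are coefficient families and the inner
    product is the quadratic form of a Gram matrix. *)

Set Implicit Arguments.
Unset Strict Implicit.
Unset Printing Implicit Defensive.
Import Order.TTheory GRing.Theory Num.Theory.
Import numFieldNormedType.Exports.

Local Open Scope classical_set_scope.
Local Open Scope ring_scope.

(** * Powers of the distance on the line are of negative type *)

Lemma sum_rank1 (R : realType) (I : finType) (b : I -> R) :
  \sum_i \sum_j b i * b j = (\sum_i b i) ^+ 2.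
Proof.
by rewrite expr2 mulr_suml; apply: eq_bigr => i _; rewrite mulr_sumr.
Qed.

Lemma quad_cvg_le (R : realType) (I : finType) (a : I -> R)
    (f : I -> I -> R^nat) (l : I -> I -> R) :
  (forall i j, f i j @ \oo --> l i j) ->
  (forall n, \sum_i \sum_j a i * a j * f i j n <= 0) ->
  \sum_i \sum_j a i * a j * l i j <= 0.
Proof.
move=> fl f0.
have h : (\sum_i \sum_j a i * a j * f i j n) @[n --> \oo] -->
    \sum_i \sum_j a i * a j * l i j.
  apply: (cvg_big (add_continuous)) => i _; apply: (cvg_big (add_continuous)) => j _.
  exact: cvgM (cvg_cst _) (fl i j).
rewrite -(cvg_lim (@Rhausdorff R) h); apply: limr_le => //; first exact: cvgP h.
by near=> n; exact: f0.
Unshelve. all: by end_near. Qed.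

(** The exponential series is a combination with nonnegative coefficients of
    the rank one kernels (s i * s j)^k. *)
Lemma expR_kernel_ge0 (R : realType) (I : finType) (b s : I -> R) (t : R) :
  0 <= t -> 0 <= \sum_i \sum_j b i * b j * expR (t * (s i * s j)).
Proof.
move=> t0; rewrite -oppr_le0 -sumrN.
under eq_bigr => i _ do rewrite -sumrN.
under eq_bigr => i _ do under eq_bigr => j _ do rewrite -mulrN.
apply: (@quad_cvg_le _ _ b (fun i j n => - series (exp_coeff (t * (s i * s j))) n)).
  by move=> i j; apply: cvgN; exact: is_cvg_series_exp_coeff.
move=> n.
under eq_bigr => i _ do under eq_bigr => j _ do rewrite mulrN.
under eq_bigr => i _ do rewrite sumrN.
rewrite sumrN oppr_le0.
under eq_bigr => i _ do under eq_bigr => j _ do rewrite mulr_sumr.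
under eq_bigr => i _ do rewrite exchange_big /=.
rewrite exchange_big /= sumr_ge0// => k _.
rewrite (_ : \sum_i _ = (t ^+ k / k`!%:R) * (\sum_i b i * s i ^+ k) ^+ 2).
  by rewrite mulr_ge0 ?sqr_ge0// divr_ge0 ?exprn_ge0.
rewrite -sum_rank1 mulr_sumr; apply: eq_bigr => i _.
rewrite mulr_sumr; apply: eq_bigr => j _.
by rewrite /exp_coeff /= !exprMn; ring.
Qed.

Definition gauss_gap (R : realType) (x : R) : R := 1 - expR (- x ^+ 2).

(** On families with sum 0 the constant 1 contributes nothing, and
    exp(- (x - y)^2) = exp(- x^2) exp(- y^2) exp(2 x y) is a positive kernel. *)
Lemma gauss_gap_negative (R : realType) (I : finType) (a s : I -> R) (c : R) :
  \sum_i a i = 0 -> \sum_i \sum_j a i * a j * gauss_gap (c * (s i - s j)) <= 0.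
Proof.
move=> a0.
have -> : \sum_i \sum_j a i * a j * gauss_gap (c * (s i - s j)) =
   \sum_i \sum_j a i * a j - \sum_i \sum_j (a i * expR (- (c * s i) ^+ 2)) *
     (a j * expR (- (c * s j) ^+ 2)) * expR (2 * ((c * s i) * (c * s j))).
  rewrite -sumrB; apply: eq_bigr => i _; rewrite -sumrB; apply: eq_bigr => j _.
  rewrite /gauss_gap mulrBr mulr1; congr (_ - _).
  rewrite -!mulrA; congr (_ * _); rewrite [RHS]mulrCA; congr (_ * _).
  by rewrite -!expRD; congr expR; ring.
rewrite sum_rank1 a0 expr0n sub0r oppr_le0.
exact: (@expR_kernel_ge0 _ _ _ (fun i => c * s i)).
Qed.

Section scales.
Variables (R : realType) (q e : R).
Hypotheses (q0 : 0 < q) (q2 : q < 2) (e0 : 0 < e).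
Implicit Type x : R.

Lemma gauss_gap_ge0 x : 0 <= gauss_gap x.
Proof. by rewrite subr_ge0 expR_le1 oppr_le0 sqr_ge0. Qed.

Lemma gauss_gap_le1 x : gauss_gap x <= 1.
Proof. by rewrite gerBl expR_ge0. Qed.

Lemma gauss_gap_le_sqr x : gauss_gap x <= x ^+ 2.
Proof. by have := expR_ge1Dx (- x ^+ 2); rewrite /gauss_gap; lra. Qed.

Lemma gauss_gap_norm x : gauss_gap `|x| = gauss_gap x.
Proof. by rewrite /gauss_gap real_normK ?num_real. Qed.

Lemma gauss_gap_le x y : 0 <= x -> x <= y -> gauss_gap x <= gauss_gap y.
Proof.
move=> x0 xy; rewrite lerD2l lerN2 ler_expR lerN2.
by rewrite ler_sqr // nnegrE (le_trans x0).
Qed.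

Lemma gauss_gap1_gt0 : 0 < gauss_gap (1 : R).
Proof. by rewrite subr_gt0 expR_lt1 expr1n oppr_lt0. Qed.

(** The contribution of the scale exp(e r) to a sum which discretizes
    the integral over t > 0 of gauss_gap (t x) t^(-1-q), a multiple of |x|^q.
    The sum is over all scales exp(e n) with n an integer; letting e tend to 0
    recovers |x|^q without any integration. *)
Definition scale_term (r : R) (x : R) := expR (- (q * (e * r))) * gauss_gap (expR (e * r) * x).

Lemma scale_term_ge0 r x : 0 <= scale_term r x.
Proof. by rewrite mulr_ge0 ?expR_ge0 ?gauss_gap_ge0. Qed.

Lemma scale_termS r x : scale_term r (expR e * x) = expR (q * e) * scale_term (r + 1) x.
Proof.
rewrite /scale_term (mulrA (expR (e * r)) (expR e)) (mulrA (expR (q * e))) -!expRD.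
by congr (expR _ * gauss_gap (expR _ * x)); ring.
Qed.

(** The nonnegative and the negative scales are paired, so that a
    series over the natural numbers covers them all. *)
Definition scale_coeff x : R^nat :=
  fun n => scale_term n%:R x + scale_term (- n.+1%:R) x.

Lemma scale_coeff_ge0 x n : 0 <= scale_coeff x n.
Proof. by rewrite addr_ge0 ?scale_term_ge0. Qed.

(** Large scales are bounded through gauss_gap <= 1 and summed because q > 0;
    small scales through gauss_gap x <= x^2, and summed because q < 2. *)
Lemma scale_coeff_le x n : scale_coeff x n <=
  geometric 1 (expR (- (q * e))) n + geometric (x ^+ 2) (expR (- ((2 - q) * e))) n.
Proof.
rewrite /geometric /= mul1r -!expRM_natr; apply: lerD.
  rewrite mulNr -mulrA -[leRHS]mulr1.
  by apply: ler_pM; rewrite ?expR_ge0 ?gauss_gap_ge0 ?gauss_gap_le1.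
apply: le_trans (ler_wpM2l (expR_ge0 _) (gauss_gap_le_sqr _)) _.
rewrite exprMn -expRM_natr (mulrA (expR _)) -expRD mulrC ler_wpM2l ?sqr_ge0// ler_expR.
rewrite (_ : _ + _ = - ((2 - q) * e * n.+1%:R)); last by ring.
rewrite mulNr lerN2 ler_wpM2l ?ler_nat// mulr_ge0 ?(ltW e0)//.
by rewrite subr_ge0 ltW.
Qed.

Lemma scale_coeff_cvg x : cvgn (series (scale_coeff x)).
Proof.
have g r c : 0 < r -> 0 <= c -> cvgn (series (geometric c (expR (- r)))).
  move=> r0 c0; apply: is_cvg_geometric_series.
  by rewrite ger0_norm ?expR_ge0// expR_lt1 oppr_lt0.
have qe : 0 < q * e by rewrite mulr_gt0.
have qe2 : 0 < (2 - q) * e by rewrite mulr_gt0 // subr_gt0.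
apply: series_le_cvg (scale_coeff_ge0 x) _ (scale_coeff_le x) _.
  by move=> n; rewrite addr_ge0// mulr_ge0 ?sqr_ge0 ?exprn_ge0 ?expR_ge0.
rewrite (_ : series _ = series (geometric 1 (expR (- (q * e)))) + series (geometric (x ^+ 2) (expR (- ((2 - q) * e)))) :> R^nat).
  by apply: is_cvgD; apply: g => //; rewrite sqr_ge0.
by apply/funext => n /=; rewrite fctE /series /= big_split.
Qed.

Definition scale_sum x : R := limn (series (scale_coeff x)).

Lemma scale_coeff_cvg0 x : scale_coeff x n @[n --> \oo] --> 0.
Proof. exact/cvg_series_cvg_0/scale_coeff_cvg. Qed.

(** The self-similarity of |x|^q survives exactly for the ratio exp e: this
    dilation shifts the series by one index. *)
Lemma scale_sumS x : scale_sum (expR e * x) = expR (q * e) * scale_sum x.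
Proof.
have h0 : scale_term n%:R x @[n --> \oo] --> 0.
  apply: squeeze_cvgr (cvg_cst 0) (scale_coeff_cvg0 x).
  by near=> n; rewrite scale_term_ge0 lerDl scale_term_ge0.
have h1 : scale_term (- n%:R) x @[n --> \oo] --> 0.
  rewrite -(cvg_shiftS (fun n => scale_term (- n%:R) x)).
  apply: squeeze_cvgr (cvg_cst 0) (scale_coeff_cvg0 x).
  by near=> n; rewrite scale_term_ge0 lerDr scale_term_ge0.
have E n : series (scale_coeff (expR e * x)) n = expR (q * e) *
    (series (scale_coeff x) n + scale_term n%:R x - scale_term (- n%:R) x).
  elim: n => [|n IH]; first by rewrite /series /= !big_geq // oppr0; ring.
  rewrite !seriesSr IH.
  rewrite /scale_coeff !scale_termS -mulrDr -mulrDr; congr (_ * _).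
  rewrite natr1 (_ : - n.+1%:R + 1 = - n%:R); last by rewrite -natr1 opprD subrK.
  by move: (scale_term _ _) (scale_term _ _) (scale_term _ _) (scale_term _ _) => *; ring.
apply: cvg_lim => //; rewrite (_ : series _ = fun n => expR (q * e) *
    (series (scale_coeff x) n + scale_term n%:R x - scale_term (- n%:R) x)).
  apply: cvgM; first exact: cvg_cst.
  rewrite -[scale_sum x]addr0 -[scale_sum x + 0]subr0.
  by apply: cvgB => //; apply: cvgD => //; exact: scale_coeff_cvg.
by apply/funext => n; exact: E.
Unshelve. all: by end_near. Qed.

Lemma scale_sum_norm x : scale_sum `|x| = scale_sum x.
Proof.
congr (limn (series _)); apply/funext => n; rewrite /scale_coeff /scale_term.
by congr (_ * _ + _ * _); rewrite -gauss_gap_norm normrM normr_id -normrM gauss_gap_norm.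
Qed.

Lemma scale_sum0 : scale_sum 0 = 0.
Proof.
rewrite /scale_sum (_ : series _ = cst 0); first exact: lim_cst.
apply/funext => n; rewrite /series /= big1 // => i _.
by rewrite /scale_coeff /scale_term !mulr0 /gauss_gap expr0n oppr0 expR0 subrr !mulr0 addr0.
Qed.

Lemma scale_sum_le x y : 0 <= x -> x <= y -> scale_sum x <= scale_sum y.
Proof.
move=> x0 xy; apply: ler_lim; [exact: scale_coeff_cvg..|].
near=> n; apply: ler_sum => i _; apply: lerD;
  by apply: ler_wpM2l; rewrite ?expR_ge0// gauss_gap_le ?mulr_ge0 ?expR_ge0// ler_wpM2l ?expR_ge0.
Unshelve. all: by end_near. Qed.

Lemma scale_sum1_gt0 : 0 < scale_sum 1.
Proof.
apply: lt_le_trans gauss_gap1_gt0 _.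
rewrite -[gauss_gap 1](_ : scale_term 0 1 = _); last first.
  by rewrite /scale_term !(mulr0, oppr0) expR0 !mul1r.
apply: limr_ge; first exact: scale_coeff_cvg.
near=> n; have n0 : (0 < n)%N by near: n; exact: nbhs_infty_gt.
rewrite /series /= big_ltn // -addrA lerDl addr_ge0 ?scale_term_ge0// sumr_ge0// => i _.
exact: scale_coeff_ge0.
Unshelve. all: by end_near. Qed.

Lemma scale_sum_int (n : int) : scale_sum (expR (n%:~R * e)) = expR (q * (n%:~R * e)) * scale_sum 1.
Proof.
have pos (m : nat) x : scale_sum (expR (m%:R * e) * x) = expR (q * (m%:R * e)) * scale_sum x.
  elim: m x => [|m IH] x; first by rewrite mul0r mulr0 expR0 !mul1r.
  rewrite -natr1 mulrDl mul1r expRD -mulrA IH scale_sumS mulrA -expRD.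
  by congr (expR _ * _); ring.
case: n => n; first by rewrite -[LHS](congr1 scale_sum (mulr1 _)) pos.
rewrite NegzE mulrNz; set r := n.+1%:~R.
have := pos n.+1 (expR (- r * e)); rewrite -expRD mulNr subrr expR0 => ->.
by rewrite mulrA -expRD mulrN addNr expR0 mul1r.
Qed.

(** Up to a factor, scale_sum agrees with |x|^q at the powers of exp e; being
    monotone, it stays within a ratio exp (q e) of it in between. *)
Lemma scale_sum_approx x d : expR (q * e) <= 1 + d ->
  `|scale_sum x / scale_sum 1 - `|x| `^ q| <= d * `|x| `^ q.
Proof.
move=> ed; have s1 := scale_sum1_gt0; rewrite -scale_sum_norm.
have [->|x0] := eqVneq x 0.
  by rewrite normr0 scale_sum0 mul0r powR0 ?gt_eqF// mulr0 subrr normr0.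
have /expR_total[y <-] : 0 < `|x| by rewrite normr_gt0.
rewrite -expRM; set n := Num.floor (y / e).
have n1 : n%:~R * e <= y by rewrite -ler_pdivlMr // Num.Theory.floor_le.
have n2 : y <= (n + 1)%:~R * e.
  by rewrite -ler_pdivrMr // ltW // Num.Theory.floorD1_gt.
have lo : expR (q * (n%:~R * e)) <= scale_sum (expR y) / scale_sum 1.
  by rewrite ler_pdivlMr// -scale_sum_int scale_sum_le ?expR_ge0 ?ler_expR.
have hi : scale_sum (expR y) / scale_sum 1 <= expR (q * ((n + 1)%:~R * e)).
  by rewrite ler_pdivrMr// -scale_sum_int scale_sum_le ?expR_ge0 ?ler_expR.
have E : expR (q * ((n + 1)%:~R * e)) = expR (q * e) * expR (q * (n%:~R * e)).
  by rewrite -expRD intrD; congr expR; ring.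
have y1 : expR (q * (n%:~R * e)) <= expR (y * q) by rewrite ler_expR mulrC ler_pM2r.
have y2 : expR (y * q) <= expR (q * ((n + 1)%:~R * e)) by rewrite ler_expR mulrC ler_pM2l.
have d0 : 0 <= d.
  have : 1 <= expR (q * e) by rewrite -expR0 ler_expR mulr_ge0 ?ltW.
  lra.
have A0 := expR_ge0 (q * (n%:~R * e)).
have h1 : expR (q * e) * expR (q * (n%:~R * e)) <= (1 + d) * expR (q * (n%:~R * e)) by rewrite ler_wpM2r.
have h2 : d * expR (q * (n%:~R * e)) <= d * expR (y * q) by rewrite ler_wpM2l.
rewrite ler_norml; move: lo hi y1 y2 h1 h2; rewrite E.
move: (expR (q * e)) (expR (q * _)) (expR (y * q)) (_ / _) => A B C D.
lra.
Qed.

Lemma scale_sum_negative (I : finType) (a s : I -> R) :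
  \sum_i a i = 0 -> \sum_i \sum_j a i * a j * scale_sum (s i - s j) <= 0.
Proof.
move=> a0; apply: (@quad_cvg_le _ _ _ (fun i j => series (scale_coeff (s i - s j)))).
  by move=> i j; exact: scale_coeff_cvg.
move=> n.
under eq_bigr => i _ do under eq_bigr => j _ do rewrite mulr_sumr.
under eq_bigr => i _ do rewrite exchange_big /=.
rewrite exchange_big /= sumr_le0// => k _.
rewrite /scale_coeff /scale_term.
under eq_bigr => i _ do under eq_bigr => j _ do rewrite mulrDr !(mulrCA (a i * a j)).
under eq_bigr => i _ do rewrite big_split /= -!mulr_sumr.
rewrite big_split /= -!mulr_sumr -[leRHS]addr0.
by apply: lerD; rewrite mulr_ge0_le0 ?expR_ge0// gauss_gap_negative.
Qed.

End scales.

(** The normalized sums scale_sum / scale_sum 1 have this property and come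
    arbitrarily close to |x|^q as the ratio of the scales tends to 1. *)
Lemma powR_negative (R : realType) (q : R) (I : finType) (a s : I -> R) :
  0 < q < 2 -> \sum_i a i = 0 ->
  \sum_i \sum_j a i * a j * `|s i - s j| `^ q <= 0.
Proof.
move=> /andP[q0 q2] a0.
set K := \sum_i \sum_j `|a i * a j| * `|s i - s j| `^ q.
have K0 : 0 <= K by do 2 (apply: sumr_ge0 => ? _); rewrite mulr_ge0 ?powR_ge0.
apply/ler_addgt0Pl => d d0; rewrite addr0.
pose d' := d / (K + 1).
have K1 : 0 < K + 1 by lra.
have d'0 : 0 < d' by rewrite divr_gt0.
pose e := ln (1 + d') / q.
have e0 : 0 < e by rewrite divr_gt0 // ln_gt0 // ltrDl.
have ed : expR (q * e) <= 1 + d' by rewrite mulrC divfK ?gt_eqF// lnK// posrE; lra.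
have S1 := scale_sum1_gt0 q0 q2 e0.
have := @scale_sum_negative _ q e q0 q2 e0 _ a s a0.
rewrite -(@pmulr_rle0 _ (scale_sum q e 1)^-1) ?invr_gt0// mulr_sumr => h.
have le : \sum_i \sum_j a i * a j * `|s i - s j| `^ q <=
  d' * K + \sum_i (scale_sum q e 1)^-1 * \sum_j a i * a j * scale_sum q e (s i - s j).
  rewrite mulr_sumr -big_split /=; apply: ler_sum => i _.
  rewrite !mulr_sumr -big_split /=; apply: ler_sum => j _.
  have := scale_sum_approx q0 q2 e0 (s i - s j) ed.
  set u := _ `^ q; set v := scale_sum q e _; set w := (scale_sum q e 1).
  move=> uv; rewrite -lerBlDr.
  apply: le_trans (ler_norm _) _.
  rewrite (_ : _ - _ = - ((a i * a j) * (v / w - u))); last by ring.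
  by rewrite normrN normrM mulrCA ler_wpM2l.
apply: le_trans le _; apply: le_trans (_ : d' * K + 0 <= _); first by rewrite lerD2l.
rewrite addr0 /d' mulrAC ler_pdivrMr // ler_pM2l//; lra.
Qed.

(** * Strictness of the negative type *)

(** At a zero of a semidefinite form, all first variations vanish: add the
    points x and y with the small weights t and - t and let t tend to 0 from
    both sides. *)
Lemma powR_potential_cst (R : realType) (q : R) (I : finType) (a s : I -> R) :
  0 < q < 2 -> \sum_i a i = 0 ->
  \sum_i \sum_j a i * a j * `|s i - s j| `^ q = 0 ->
  forall x y, \sum_i a i * `|x - s i| `^ q = \sum_i a i * `|y - s i| `^ q.
Proof.
move=> q02 a0 Q0 x y; set g := fun z => \sum_i a i * `|z - s i| `^ q.
have q0 : q != 0 by case/andP: q02 => ? _; rewrite gt_eqF.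
rewrite -/(g x) -/(g y).
pose D := `|x - y| `^ q.
have key t : t * (g x - g y) <= t ^+ 2 * D.
  pose a' (u : I + bool) := match u with inl i => a i | inr b => if b then t else - t end.
  pose s' (u : I + bool) := match u with inl i => s i | inr b => if b then x else y end.
  have := @powR_negative R q _ a' s' q02.
  rewrite big_sumType /= a0 big_bool /= subrr addr0 => /(_ erefl).
  rewrite big_sumType /= big_bool /=.
  under eq_bigr do rewrite big_sumType /= big_bool /=.
  rewrite big_split /= Q0 !big_sumType /= !big_bool /= !subrr normr0 powR0 // !mulr0 !add0r addr0.
  have E z w : \sum_i w * a i * `|z - s i| `^ q = w * g z.
    by rewrite mulr_sumr; apply: eq_bigr => i _; rewrite mulrA.
  rewrite big_split /=.
  have E' z w : \sum_i a i * w * `|s i - z| `^ q = w * g z.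
    by rewrite mulr_sumr; apply: eq_bigr => i _; rewrite mulrA (mulrC w) distrC.
  rewrite !E !E' (distrC y x) -/D.
  lra.
have D0 : 0 <= D by exact: powR_ge0.
have := key ((g x - g y) / (D + 1)).
set b := g x - g y => h.
have D1 : 0 < D + 1 by lra.
have : b ^+ 2 <= 0.
  move: h; rewrite exprMn mulrAC -expr2 ler_pdivrMr// exprVn.
  rewrite (_ : _ * (D + 1) = b ^+ 2 * (D / (D + 1))); last by field; rewrite gt_eqF.
  move=> h; have : b ^+ 2 * (1 - D / (D + 1)) <= 0 by lra.
  rewrite (_ : 1 - _ = (D + 1)^-1); last by field; rewrite gt_eqF.
  by rewrite pmulr_lle0 // invr_gt0.
move=> b2; have : b ^+ 2 == 0 by rewrite eq_le b2 sqr_ge0.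
by rewrite sqrf_eq0 subr_eq0 => /eqP.
Qed.

Lemma powR_bernoulli (R : realType) (x r : R) : 0 <= r -> r <= 1 -> 0 <= x ->
  x `^ r <= 1 + r * (x - 1).
Proof.
move=> r0 r1; rewrite le_eqVlt => /orP[/eqP<-|x0].
  have [->|r0'] := eqVneq r 0; first by rewrite powRr0; lra.
  by rewrite powR0 //; lra.
have [y <-] := expR_total x0; rewrite -expRM.
have h0 : 0 <= r <= 1 by rewrite r0.
have := @convex_expR R (Itv01 r0 r1) y 0.
rewrite expR0 !convRE /= mulr0 addr0 mulrC /unstable.onem => h.
by apply: le_trans h _; rewrite mulr1; lra.
Qed.

(** With t = h / d and r = q / 2 <= 1 this is a bound for
    (1 + t)^(2 r) + (1 - t)^(2 r) - 2; the concavity of the power r gives the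
    upper bound, the inequality of the means the lower one. *)
Lemma powR_second_difference (R : realType) (q d h : R) : 0 < q < 2 -> d != 0 ->
  `|h| <= `|d| ->
  `| `|d + h| `^ q + `|d - h| `^ q - 2 * `|d| `^ q| <= 2 * `|d| `^ q * (h / d) ^+ 2.
Proof.
move=> /andP[q0 q2] d0 hd.
set t := h / d.
have t1 : `|t| <= 1 by rewrite normrM normfV ler_pdivrMr ?normr_gt0// mul1r.
have -> : d + h = d * (1 + t) by rewrite /t; field.
have -> : d - h = d * (1 - t) by rewrite /t; field.
rewrite !(normrM d) !powRM // -mulrA mulrCA.
rewrite (_ : _ + _ - _ = `|d| `^ q * (`|1 + t| `^ q + `|1 - t| `^ q - 2)); last by ring.
rewrite normrM ger0_norm ?powR_ge0// ler_wpM2l ?powR_ge0//.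
pose r := q / 2.
have r0 : 0 <= r by rewrite /r; lra.
have r1 : r <= 1 by rewrite /r; lra.
have sq x : `|x| `^ q = (x ^+ 2) `^ r.
  rewrite -real_normK ?num_real// -powR_mulrn // -powRrM /r; congr (_ `^ _).
  by rewrite mulrC divfK.
rewrite !sq ler_norml; move: t1; rewrite ler_norml => /andP[t1 t2].
have b1 := powR_bernoulli r0 r1 (sqr_ge0 (1 + t)).
have b2 := powR_bernoulli r0 r1 (sqr_ge0 (1 - t)).
have T : 0 <= t ^+ 2 by exact: sqr_ge0.
have u1 : ((1 + t) ^+ 2) `^ r + ((1 - t) ^+ 2) `^ r <= 2 + 2 * r * t ^+ 2.
  apply: le_trans (lerD b1 b2) _; rewrite le_eqVlt; apply/orP; left; apply/eqP; ring.
have u2 : 2 * r * t ^+ 2 <= 2 * t ^+ 2 by rewrite ler_wpM2r //; lra.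
have l1 : 1 - t ^+ 2 <= (1 - t ^+ 2) `^ r.
  have [->|nz] := eqVneq (1 - t ^+ 2) 0; first exact: powR_ge0.
  apply: ger1_powR => //; rewrite gerBl T andbT lt0r nz /=; nra.
have l2 : 2 * (1 - t ^+ 2) `^ r <= ((1 + t) ^+ 2) `^ r + ((1 - t) ^+ 2) `^ r.
  set A := (1 + t) `^ r; set B := (1 - t) `^ r.
  have -> : 1 - t ^+ 2 = (1 + t) * (1 - t) by ring.
  rewrite !expr2 !powRM -/A -/B; [|lra..].
  have := sqr_ge0 (A - B); rewrite sqrrB mulr2n expr2 expr2; lra.
apply/andP; split; lra.
Qed.

(** By [powR_potential_cst] the potential of the family is constant. Its second
    difference with step h at x is 2 h^q times the weight at x, up to an error
    of order h^2; as q < 2 that weight is 0. *)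
Lemma powR_negative_strict (R : realType) (q : R) (I : finType) (a s : I -> R) :
  0 < q < 2 -> \sum_i a i = 0 ->
  \sum_i \sum_j a i * a j * `|s i - s j| `^ q = 0 ->
  forall x, \sum_(i | s i == x) a i = 0.
Proof.
move=> q02 a0 Q0 x; have /andP[q0 q2] := q02.
have qn0 : q != 0 by rewrite gt_eqF.
pose A := \sum_(i | s i == x) a i.
pose C := \sum_(i | s i != x) `|a i| * (2 * `|x - s i| `^ q * (x - s i) ^- 2).
have C0 : 0 <= C.
  by apply: sumr_ge0 => i _; rewrite !mulr_ge0 ?powR_ge0 ?invr_ge0 ?sqr_ge0.
have key h : 0 < h -> (forall i, s i != x -> h <= `|x - s i|) ->
    2 * `|A| <= h `^ (2 - q) * C.
  move=> h0 hs.
  have cst := powR_potential_cst q02 a0 Q0.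
  have : \sum_i a i * `|x + h - s i| `^ q + \sum_i a i * `|x - h - s i| `^ q
       - 2 * \sum_i a i * `|x - s i| `^ q = 0.
    by rewrite (cst (x + h) x) (cst (x - h) x); ring.
  rewrite mulr_sumr -big_split -sumrB /=.
  rewrite (bigID (fun i => s i == x)) /=.
  rewrite (_ : \sum_(i | s i == x) _ = 2 * h `^ q * A); last first.
    rewrite mulr_sumr; apply: eq_bigr => i /eqP ->.
    rewrite subrr normr0 powR0 // (_ : x + h - x = h); last by ring.
    rewrite (_ : x - h - x = - h); last by ring.
    by rewrite normrN gtr0_norm//; ring.
  move=> /eqP; rewrite addr_eq0 => /eqP E.
  have hq : 0 < h `^ q by exact: powR_gt0.
  have h2 : h `^ (2 - q) * h `^ q = h ^+ 2.
    by rewrite -powRD ?subrK ?powR_mulrn ?ltW// gt_eqF// implybT.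
  rewrite -(ler_pM2r hq) [leRHS]mulrAC h2 [leLHS]mulrAC.
  have -> : 2 * h `^ q * `|A| = `|2 * h `^ q * A|.
    by rewrite normrM (ger0_norm (_ : 0 <= 2 * h `^ q)) // mulr_ge0 // ltW.
  rewrite E normrN /C mulr_sumr; apply: le_trans (ler_norm_sum _ _ _) _.
  apply: ler_sum => i six.
  have d0 : x - s i != 0 by rewrite subr_eq0 eq_sym.
  have := @powR_second_difference R q (x - s i) h q02 d0.
  rewrite (gtr0_norm h0) => /(_ (hs _ six)).
  rewrite (addrAC x (- s i)) (addrAC x (- s i)) => H.
  rewrite mulrCA -mulrDr -mulrBr normrM mulrCA ler_wpM2l//.
  by apply: le_trans H _; rewrite exprMn exprVn mulrCA mulrA.
apply/eqP; apply: contraT; rewrite -/A -normr_gt0 => A0.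
pose d := \big[Order.min/1]_(i | s i != x) `|x - s i|.
have d0 : 0 < d.
  by apply/bigmin_gtP; split => // i six; rewrite normr_gt0 subr_eq0 eq_sym.
have q2' : 0 < 2 - q by lra.
have C1 : 0 < C + 1 by lra.
pose w := (`|A| / (C + 1)) `^ (2 - q)^-1.
have w0 : 0 < w by rewrite powR_gt0// divr_gt0.
pose h := Order.min d w.
have h0 : 0 < h by rewrite lt_min d0.
have hd i : s i != x -> h <= `|x - s i|.
  by move=> six; rewrite ge_min; apply/orP; left; exact: (@bigmin_le_cond _ _ I (1 : R) i (fun i => s i != x) _ six).
have hw : h `^ (2 - q) <= `|A| / (C + 1).
  have : h `^ (2 - q) <= w `^ (2 - q).
    by apply: ge0_ler_powR; rewrite ?nnegrE ?(ltW q2') ?(ltW h0) ?(ltW w0)// ge_min lexx orbT.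
  rewrite /w -powRrM mulVf ?gt_eqF// powRr1// divr_ge0 ?normr_ge0 //; lra.
have := key h h0 hd.
have : h `^ (2 - q) * C <= `|A|.
  apply: le_trans (ler_wpM2r C0 hw) _.
  by rewrite mulrAC ler_pdivrMr // ler_pM2l //; lra.
lra.
Qed.

(** * Closed polygons of total curvature at most 2 pi *)

Lemma binary_form_disc (R : realType) (s k s' : R) :
  (forall r t, 0 <= r ^+ 2 * s + t ^+ 2 * s' + 2 * r * t * k) -> k ^+ 2 <= s * s'.
Proof.
move=> h.
have s0 : 0 <= s by have := h 1 0; rewrite expr1n expr0n /=; lra.
have s'0 : 0 <= s' by have := h 0 1; rewrite expr1n expr0n /=; lra.
have [E|s'n0] := eqVneq s' 0.
  rewrite E mulr0; have := h k (- (s + 1) / 2); rewrite E mulr0 addr0.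
  rewrite (_ : _ + _ = - k ^+ 2); last by field.
  by rewrite oppr_ge0.
have s'p : 0 < s' by rewrite lt0r s'n0.
have := h s' (- k); rewrite (_ : _ + _ = s' * (s * s' - k ^+ 2)); last by ring.
by rewrite pmulr_rge0 // subr_ge0.
Qed.

Lemma cos_le (R : realType) (x y : R) : 0 <= x -> x <= y -> y <= pi -> cos y <= cos x.
Proof.
by move=> x0 xy yp; rewrite leNgt ltr_cos ?in_itv /=; lra.
Qed.

(** The hypothesis is that a, b, c are the inner products of three unit
    vectors. On the sphere, the angle c is at most the sum of the angles a and b. *)
Lemma spherical_triangle (R : realType) (a b c al be : R) :
  (forall r s t, 0 <= r ^+ 2 + s ^+ 2 + t ^+ 2 + 2 * r * s * a + 2 * s * t * b + 2 * r * t * c) ->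
  0 <= al -> 0 <= be -> al + be <= pi -> cos al <= a -> cos be <= b ->
  cos (al + be) <= c.
Proof.
move=> h al0 be0 ab ca cb.
have a1 : -1 <= a <= 1.
  have := h 1 1 0; have := h 1 (-1) 0; rewrite expr0n /= sqrrN expr1n; lra.
have b1 : -1 <= b <= 1.
  have := h 0 1 1; have := h 0 1 (-1); rewrite expr0n /= sqrrN expr1n; lra.
(* Gram inequality for the components orthogonal to the middle vector *)
have k : (c - a * b) ^+ 2 <= (1 - a ^+ 2) * (1 - b ^+ 2).
  apply: binary_form_disc => r t.
  have := h r (- (r * a + t * b)) t; congr (0 <= _); ring.
pose A := acos a; pose C := acos b.
have A0 : 0 <= A by exact: acos_ge0.
have C0 : 0 <= C by exact: acos_ge0.
have cA : cos A = a by rewrite /A acosK.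
have cC : cos C = b by rewrite /C acosK.
have Aal : A <= al.
  rewrite leNgt; apply/negP => alA; move: ca; rewrite -cA leNgt ltr_cos ?alA//.
    by rewrite in_itv /= al0; lra.
  by rewrite in_itv /= A0 acos_lepi.
have Cbe : C <= be.
  rewrite leNgt; apply/negP => alC; move: cb; rewrite -cC leNgt ltr_cos ?alC//.
    by rewrite in_itv /= be0; lra.
  by rewrite in_itv /= C0 acos_lepi.
apply: le_trans (_ : cos (A + C) <= _).
  by apply: cos_le; lra.
have sA : 0 <= sin A by apply: sin_ge0_pi; rewrite A0 acos_lepi.
have sC : 0 <= sin C by apply: sin_ge0_pi; rewrite C0 acos_lepi.
move: k; rewrite -cA -cC -!sin2cos2 -exprMn cosD.
have sAC : 0 <= sin A * sin C by exact: mulr_ge0.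
move: (sin A * sin C) (cos A * cos C) sAC => S D S0 k.
by rewrite leNgt; apply/negP => lt; nra.
Qed.

Section gram.
Variables (R : realType) (T : finType) (H : T -> T -> R).
Hypothesis HC : forall i j, H i j = H j i.
Hypothesis Hpos : forall x : T -> R, 0 <= \sum_i \sum_j x i * x j * H i j.

Definition form (x y : T -> R) := \sum_i \sum_j x i * y j * H i j.

Lemma formC x y : form x y = form y x.
Proof.
rewrite /form exchange_big /=; apply: eq_bigr => i _; apply: eq_bigr => j _.
by rewrite HC (mulrC (x j)).
Qed.

Lemma formDl x y z r s : form (fun i => r * x i + s * y i) z = r * form x z + s * form y z.
Proof.
rewrite /form !mulr_sumr -big_split; apply: eq_bigr => i _ /=.
by rewrite !mulr_sumr -big_split; apply: eq_bigr => j _ /=; ring.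
Qed.

Lemma formDr x y z r s : form z (fun i => r * x i + s * y i) = r * form z x + s * form z y.
Proof. by rewrite formC formDl !(formC z). Qed.

(** The basis vector written e_i below: its products with the other basis
    vectors are the entries of H. *)
Definition unitv (i : T) : T -> R := fun j => (j == i)%:R.

Lemma form_unitl i x : form (unitv i) x = \sum_j x j * H i j.
Proof.
rewrite /form (bigD1 i) //= [X in _ + X]big1 ?addr0.
  by apply: eq_bigr => j _; rewrite /unitv eqxx mul1r.
by move=> j ji; rewrite big1 // => k _; rewrite /unitv (negbTE ji) !mul0r.
Qed.

Lemma form_unit i j : form (unitv i) (unitv j) = H i j.
Proof.
rewrite form_unitl (bigD1 j) //= big1 ?addr0 => [|k kj].
  by rewrite /unitv eqxx mul1r.
by rewrite /unitv (negbTE kj) mul0r.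
Qed.

Lemma form_triangle x y z al be : form x x = 1 -> form y y = 1 -> form z z = 1 ->
  0 <= al -> 0 <= be -> al + be <= pi ->
  cos al <= form x y -> cos be <= form y z -> cos (al + be) <= form x z.
Proof.
move=> x1 y1 z1; apply: spherical_triangle => r s t.
have := Hpos (fun i => 1 * (r * x i + s * y i) + t * z i).
rewrite -/(form _ _) !(formDl, formDr) x1 y1 z1 (formC y x) (formC z x) (formC z y).
by congr (0 <= _); ring.
Qed.

Hypothesis H1 : forall i, H i i = 1.
Variables (tau : T -> R) (o : T).
Hypothesis tau0 : tau o = 0.
Hypothesis tau_itv : forall i, 0 <= tau i < 2 * pi.
Hypothesis tau_inj : injective tau.
Hypothesis Hnext : forall i j, tau i < tau j ->
  (forall k, tau i < tau k -> tau j <= tau k) -> cos (tau j - tau i) <= H i j.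
Hypothesis Hlast : forall i, (forall k, tau k <= tau i) ->
  cos (2 * pi - tau i) <= H i o.

Lemma form_unit1 i : form (unitv i) (unitv i) = 1.
Proof. by rewrite form_unit H1. Qed.

(** A chain of consecutive unit vectors, each within the planar angle of the
    next, is no longer than in the plane. *)
Lemma form_chain i j : tau i <= tau j -> tau j - tau i <= pi ->
  cos (tau j - tau i) <= H i j.
Proof.
have [n] := ubnP #|[set k | (tau i < tau k) && (tau k <= tau j)]%SET|.
elim: n j => // n IH j cn; rewrite le_eqVlt => /orP[/eqP/tau_inj<- _|ij ijp].
  by rewrite subrr cos0 H1.
pose P := [pred k | tau k < tau j].
have Pi : P i by [].
case: (@Order.TotalTheory.arg_maxP _ R T i P tau Pi) => k kj kmax.
have ik : tau i <= tau k by exact: kmax.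
have {}kj : tau k < tau j by exact: kj.
rewrite (_ : tau j - tau i = (tau k - tau i) + (tau j - tau k)); last by ring.
rewrite -form_unit; apply: (@form_triangle _ (unitv k)); rewrite ?form_unit1 ?form_unit//; try lra.
- apply: IH => //; last by lra.
  rewrite -ltnS; apply: leq_trans cn; apply: proper_card; apply/properP; split.
    by apply/fintype.subsetP => l; rewrite !inE => /andP[-> /=] h; lra.
  by exists j; rewrite !inE ?ij ?lexx// negb_and -!ltNge kj orbT.
- apply: Hnext => // l kl; rewrite leNgt; apply/negP => lj.
  have : tau l <= tau k by exact: kmax.
  by rewrite leNgt kl.
Qed.

Variables (a b : T).
Hypothesis a_pi : tau a <= pi.
Hypothesis a_max : forall i, tau i <= pi -> tau i <= tau a.
Hypothesis b_pi : pi < tau b.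
Hypothesis b_min : forall i, pi < tau i -> tau b <= tau i.
Hypothesis ab_pi : tau b - tau a < pi.

(** The vectors e_a and e_b are at distance at most the sum of pi - tau a and
    tau b - pi. So there is a point on the arc between them which is within the
    first distance of e_a and the second of e_b: an end of the arc, or the point
    at distance exactly pi - tau a from e_a. *)
Lemma geodesic_point : exists x2 x3, [/\ 0 <= x2, 0 <= x3,
  cos (pi - tau a) <= form (unitv a) (fun i => x2 * unitv a i + x3 * unitv b i),
  cos (tau b - pi) <= form (unitv b) (fun i => x2 * unitv a i + x3 * unitv b i) &
  form (fun i => x2 * unitv a i + x3 * unitv b i) (fun i => x2 * unitv a i + x3 * unitv b i) = 1].
Proof.
pose da := pi - tau a; pose db := tau b - pi; pose c := H a b.
have da0 : 0 <= da by rewrite subr_ge0.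
have db0 : 0 < db by rewrite subr_gt0.
have dabE : da + db = tau b - tau a by rewrite /da /db; ring.
have dab : da + db < pi by rewrite dabE.
have cab : cos (da + db) <= c.
  rewrite dabE.
  by apply: Hnext => [|k ak]; [lra|apply: b_min; rewrite ltNge; apply/negP => /a_max ?; lra].
have c1 : -1 <= c <= 1.
  have := Hpos (fun i => 1 * unitv a i + 1 * unitv b i).
  have := Hpos (fun i => 1 * unitv a i + (-1) * unitv b i).
  rewrite -!/(form _ _) !(formDl, formDr) !form_unit1 !form_unit (HC b a) -/c; lra.
have [cdb|cdb] := leP (cos db) c.
  exists 1, 0; rewrite !(formDl, formDr) !form_unit1 !form_unit (HC b a) -/c.
  by have := cos_le1 (pi - tau a); rewrite -/db; split; lra.
have [cda|cda] := leP (cos da) c.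
  exists 0, 1; rewrite !(formDl, formDr) !form_unit1 !form_unit (HC b a) -/c.
  by have := cos_le1 (tau b - pi); rewrite -/da; split; lra.
pose psi := acos c.
have cpsi : cos psi = c by rewrite acosK.
have psi0 : 0 <= psi by exact: acos_ge0.
have psipi : psi <= pi by exact: acos_lepi.
have psidab : psi <= da + db.
  rewrite leNgt; apply/negP => lt; move: cab; rewrite -cpsi leNgt ltr_cos ?lt//.
    by rewrite in_itv /=; lra.
  by rewrite in_itv /= psi0.
have dapsi : da < psi.
  rewrite ltNge; apply/negP => le; move: cda; rewrite -cpsi ltNge cos_le//; lra.
have s0 : 0 < sin psi by apply: sin_gt0_pi; lra.
(* spherical interpolation *)
exists (sin (psi - da) / sin psi), (sin da / sin psi).
rewrite !(formDl, formDr) !form_unit1 !form_unit (HC b a) -/c -cpsi.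
have E1 : sin (psi - da) / sin psi * 1 + sin da / sin psi * cos psi = cos da.
  by rewrite sinB; field; rewrite gt_eqF.
have E2 : sin (psi - da) / sin psi * cos psi + sin da / sin psi * 1 = cos (psi - da).
  apply: (mulIf (lt0r_neq0 s0)).
  rewrite (_ : (_ + _) * _ = sin (psi - da) * cos psi + sin da); last by field; rewrite gt_eqF.
  have -> : sin da = sin psi * cos (psi - da) - cos psi * sin (psi - da).
    by rewrite -sinB; congr sin; ring.
  by ring.
split.
- by rewrite divr_ge0 ?(ltW s0)// sin_ge0_pi//; lra.
- by rewrite divr_ge0 ?(ltW s0)// sin_ge0_pi//; lra.
- by rewrite E1.
- rewrite E2; apply: cos_le; rewrite -?/db; lra.
- rewrite (_ : _ + _ = sin (psi - da) / sin psi * cos da + sin da / sin psi * cos (psi - da)).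
    rewrite mulrAC (mulrAC (sin da)) -mulrDl (mulrC (sin da)) -sinD.
    by rewrite subrK divff ?gt_eqF.
  by rewrite -E1 -E2; ring.
Qed.

(** The vector e_o + g, where g is the point of [geodesic_point], which plays
    the role of the direction opposite to e_o. *)
Definition opposite_vec x2 x3 i := 1 * unitv o i + 1 * (x2 * unitv a i + x3 * unitv b i).

(** The angles from e_i to e_o and to g add up to at most pi: going from e_o to
    g through e_i has length pi in the plane, on either side. *)
Lemma opposite_vec_ge0 x2 x3 : let g := fun i => x2 * unitv a i + x3 * unitv b i in
  cos (pi - tau a) <= form (unitv a) g -> cos (tau b - pi) <= form (unitv b) g ->
  form g g = 1 -> forall i, 0 <= form (unitv i) (opposite_vec x2 x3).
Proof.
move=> g ga gb g1 i; have ap := a_pi; have bp := b_pi; rewrite formDr !mul1r form_unit -/g.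
have [i0 i2] := andP (tau_itv i).
have [ip|ip] := leP (tau i) pi.
  have io : cos (tau i) <= H i o.
    by rewrite HC -[tau i]subr0 -tau0; apply: form_chain; rewrite tau0 ?subr0.
  have ia := a_max ip.
  have : cos ((tau a - tau i) + (pi - tau a)) <= form (unitv i) g.
    apply: (@form_triangle _ (unitv a)); rewrite ?form_unit1 ?form_unit ?subr_ge0 //; first lra.
    by apply: form_chain => //; lra.
  rewrite (_ : _ + _ = - (tau i) + pi); last by ring.
  by rewrite cosDpi cosN; lra.
have ib := b_min ip.
have io : cos (2 * pi - tau i) <= H i o.
  have Pi : xpredT i by [].
  case: (@Order.TotalTheory.arg_maxP _ R T i xpredT tau Pi) => k _ kmax.
  have ik : tau i <= tau k by exact: kmax.
  have [k0 k2] := andP (tau_itv k).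
  rewrite (_ : 2 * pi - tau i = (tau k - tau i) + (2 * pi - tau k)); last by ring.
  rewrite -form_unit; apply: (@form_triangle _ (unitv k)); rewrite ?form_unit1 ?form_unit //; try lra.
    by apply: form_chain => //; lra.
  by apply: Hlast => l; exact: kmax.
have : cos ((tau i - tau b) + (tau b - pi)) <= form (unitv i) g.
  apply: (@form_triangle _ (unitv b)); rewrite ?form_unit1 ?form_unit ?subr_ge0 // ?(ltW b_pi) //; first lra.
  by rewrite HC; apply: form_chain => //; lra.
move: io; rewrite (_ : tau i - tau b + _ = - (- tau i + pi)); last by ring.
rewrite (_ : 2 * pi - tau i = (- tau i + pi) + pi); last by ring.
by rewrite cosN !cosDpi cosN; lra.
Qed.

Variable l : T -> R.
Hypothesis l_gt0 : forall i, 0 < l i.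
Hypothesis l_closed : forall j, \sum_i l i * H i j = 0.

(** The sides l i *: e_i of the closed polygon add up to 0, whereas each has a
    nonnegative product with e_o + g. Hence all products are 0, and so is the
    norm of e_o + g. *)
Lemma closed_polygon_isotropic : exists x2 x3, [/\ 0 <= x2, 0 <= x3 &
  form (opposite_vec x2 x3) (opposite_vec x2 x3) = 0].
Proof.
have [x2 [x3 [x20 x30 ga gb g1]]] := geodesic_point.
exists x2, x3; split => //; have M0 := opposite_vec_ge0 ga gb g1.
set M := opposite_vec x2 x3 in M0 *.
have Ml : \sum_i l i * form (unitv i) M = 0.
  under eq_bigr => i _ do rewrite form_unitl mulr_sumr.
  rewrite exchange_big big1 //= => j _.
  by under eq_bigr => i _ do rewrite mulrCA; rewrite -mulr_sumr l_closed mulr0.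
have Mi i : form (unitv i) M = 0.
  have /eqP := Ml; rewrite psumr_eq0 => [|k _]; last by rewrite mulr_ge0// ltW.
  by move=> /allP /(_ i (mem_index_enum _)); rewrite mulf_eq0 gt_eqF//= => /eqP.
rewrite /form; apply: big1 => i _.
have := Mi i; rewrite form_unitl => E.
transitivity (M i * \sum_j M j * H i j); last by rewrite E mulr0.
by rewrite mulr_sumr; apply: eq_bigr => j _; rewrite mulrA.
Qed.

End gram.

(** * Stars of masses and angles *)

(** The partial sum of the masses that precede i in the order of the angles:
    edge i is the step from below i to below i + m i. *)
Definition below (R : realType) (T : finType) (tau m : T -> R) (i : T) : R :=
  \sum_(j | tau j < tau i) m j.

(** In increasing order of tau this is a telescoping sum; the induction removes
    the last edge, which avoids sorting. *)
Lemma below_telescope (R : realType) (T : finType) (tau m : T -> R) (f : R -> R) :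
  injective tau ->
  \sum_i (f (below tau m i + m i) - f (below tau m i)) = f (\sum_i m i) - f 0.
Proof.
move=> inj.
suff key n (D : {set T}) : (#|D| <= n)%N ->
    (forall i j, i \in D -> tau j < tau i -> j \in D) ->
    \sum_(i in D) (f (below tau m i + m i) - f (below tau m i)) =
    f (\sum_(i in D) m i) - f 0.
  have := key #|T| [set: T]%SET; rewrite max_card => /(_ isT).
  under eq_bigl => i do rewrite inE; under [in RHS]eq_bigl => i do rewrite inE.
  by move=> -> // i j; rewrite !inE.
elim: n D => [D|n IH D cD Dd].
  by rewrite leqn0 cards_eq0 => /eqP -> _; rewrite !big_set0 subrr.
have [->|[i iD]] := set_0Vmem D; first by rewrite !big_set0 subrr.
case: (@Order.TotalTheory.arg_maxP _ R T i (fun i => i \in D) tau iD) => k kD kmax.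
have bk : below tau m k = \sum_(j in D :\ k) m j.
  apply: eq_bigl => j; rewrite !inE; apply/idP/andP => [jk|[jk jD]].
    by split; [apply: contraTneq jk => ->; rewrite ltxx|exact: Dd jk].
  have jk' : tau j <= tau k by exact: kmax.
  by rewrite lt_neqAle jk' andbT (inj_eq inj).
rewrite (big_setD1 k) //= [in RHS](big_setD1 k) //= IH.
- by rewrite bk (addrC (m k)); ring.
- by move: cD; rewrite (cardsD1 k) kD.
- move=> u w; rewrite !inE => /andP[uk uD] wu; rewrite (Dd u w)// andbT.
  apply: contraTneq wu => ->; rewrite -leNgt; exact: kmax.
Qed.

Section increments.
Variables (R : realType) (q : R) (T : finType) (sp sm : T -> R).

(** The covariance of the increments from sm i to sp i and from sm j to sp j of
    a fractional Brownian motion, a process with E (B x - B y)^2 = |x - y|^q. *)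
Definition incr_gram (i j : T) : R := 2^-1 *
  (`|sp i - sm j| `^ q + `|sm i - sp j| `^ q - `|sp i - sp j| `^ q - `|sm i - sm j| `^ q).

Let pt (u : T * bool) := if u.2 then sp u.1 else sm u.1.
Let wt (x : T -> R) (u : T * bool) := if u.2 then x u.1 else - x u.1.

Let sum_pair (F : T * bool -> R) : \sum_u F u = \sum_i (F (i, true) + F (i, false)).
Proof.
rewrite (eq_bigr (fun u => F (u.1, u.2))) => [|[i b]//].
rewrite -(pair_bigA _ (fun i b => F (i, b))) /=.
by apply: eq_bigr => i _; rewrite big_bool.
Qed.

Lemma incr_gramC i j : incr_gram i j = incr_gram j i.
Proof.
rewrite /incr_gram (distrC (sp j)) (distrC (sm j) (sp i)) (distrC (sp j)) (distrC (sm j)).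
by ring.
Qed.

Lemma incr_quad x : \sum_u \sum_v wt x u * wt x v * `|pt u - pt v| `^ q =
  - (2 * \sum_i \sum_j x i * x j * incr_gram i j).
Proof.
rewrite sum_pair mulr_sumr -sumrN; apply: eq_bigr => i _.
rewrite !sum_pair -big_split mulr_sumr -sumrN /=; apply: eq_bigr => j _.
by rewrite /pt /wt /incr_gram /=; field.
Qed.

Lemma incr_gram_ge0 x : 0 < q < 2 -> 0 <= \sum_i \sum_j x i * x j * incr_gram i j.
Proof.
move=> q02; have := @powR_negative R q _ (wt x) pt q02.
rewrite incr_quad sum_pair big1 => [/(_ erefl)|i _]; last by rewrite /wt /= subrr.
by rewrite oppr_le0 pmulr_rge0.
Qed.

(** A combination of increments of variance 0 is trivial: the point masses at
    the ends of the steps cancel. *)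
Lemma incr_gram_kernel x : 0 < q < 2 -> \sum_i \sum_j x i * x j * incr_gram i j = 0 ->
  forall y, \sum_i x i * ((sp i == y)%:R - (sm i == y)%:R) = 0.
Proof.
move=> q02 x0 y; have := @powR_negative_strict R q _ (wt x) pt q02.
rewrite incr_quad x0 mulr0 oppr0 sum_pair big1 => [/(_ erefl erefl y)|i _]; last first.
  by rewrite /wt /= subrr.
move=> h; rewrite -[RHS]h [RHS]big_mkcond sum_pair /=; apply: eq_bigr => i _; rewrite /pt /wt /=.
by case: eqP; case: eqP => _ _ /=; ring.
Qed.

End increments.

Section polar.
Variables (R : realType) (T : finType) (m tau : T -> R) (p : R) (o : T).
Hypothesis p01 : 0 < p < 1.
Hypothesis m_neq0 : forall i, m i != 0.
Hypothesis m_sum : \sum_i m i = 0.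
Hypothesis tau0 : tau o = 0.
Hypothesis tau_itv : forall i, 0 <= tau i < 2 * pi.
Hypothesis tau_inj : injective tau.
Let len i := `|m i| `^ p.
Hypothesis sub_le : forall D : {set T},
  (\sum_(i in D) len i * cos (tau i)) ^+ 2 + (\sum_(i in D) len i * sin (tau i)) ^+ 2
    <= `|\sum_(i in D) m i| `^ (2 * p).

Let len_gt0 i : 0 < len i.
Proof. by rewrite powR_gt0 ?normr_gt0. Qed.

Let q02 : 0 < 2 * p < 2.
Proof. by case/andP: p01 => ? ?; apply/andP; split; lra. Qed.

Let q_neq0 : 2 * p != 0.
Proof. by case/andP: q02 => ? _; rewrite gt_eqF. Qed.

Let len_sqr i : len i ^+ 2 = `|m i| `^ (2 * p).
Proof. by rewrite /len -powR_mulrn ?powR_ge0// -powRrM mulrC. Qed.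

(** With no total mass, a set of edges could be split off at no cost for the
    new edge, hence its forces balance on their own. *)
Lemma null_sums (D : {set T}) : \sum_(i in D) m i = 0 ->
  \sum_(i in D) len i * cos (tau i) = 0 /\ \sum_(i in D) len i * sin (tau i) = 0.
Proof.
move=> D0; have := sub_le D; rewrite D0 normr0 powR0//.
set x := \sum_(i in D) _ * cos _; set y := \sum_(i in D) _ * sin _ => h.
have x2 := sqr_ge0 x; have y2 := sqr_ge0 y.
have /eqP : x ^+ 2 = 0 by lra.
have /eqP : y ^+ 2 = 0 by lra.
by rewrite !sqrf_eq0 => /eqP -> /eqP ->.
Qed.

Lemma null_upper (D : {set T}) : \sum_(i in D) m i = 0 ->
  (forall i, i \in D -> 0 <= sin (tau i)) -> forall i, i \in D -> sin (tau i) = 0.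
Proof.
move=> /null_sums[_ /eqP] + Dp i iD; rewrite psumr_eq0 => [|j jD]; last first.
  by rewrite mulr_ge0 ?(ltW (len_gt0 _))// Dp.
by move=> /allP /(_ i (mem_index_enum _)); rewrite iD /= mulf_eq0 gt_eqF//= => /eqP.
Qed.

Lemma null_lower (D : {set T}) : \sum_(i in D) m i = 0 ->
  (forall i, i \in D -> sin (tau i) <= 0) -> forall i, i \in D -> sin (tau i) = 0.
Proof.
move=> /null_sums[_ /eqP] + Dp i iD; rewrite -oppr_eq0 -sumrN psumr_eq0 => [|j jD]; last first.
  by rewrite -mulrN mulr_ge0 ?(ltW (len_gt0 _))// oppr_ge0 Dp.
move=> /allP /(_ i (mem_index_enum _)); rewrite iD /= oppr_eq0 mulf_eq0 gt_eqF//=.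
by move=> /eqP.
Qed.

Lemma m_sumT : \sum_(i in [set: T]%SET) m i = 0.
Proof. by rewrite -[RHS]m_sum; apply: eq_bigl => i; rewrite inE. Qed.

Lemma sum_polar : \sum_i len i * cos (tau i) = 0 /\ \sum_i len i * sin (tau i) = 0.
Proof.
have [h1 h2] := null_sums m_sumT; split.
  by rewrite -[RHS]h1; apply: eq_bigl => i; rewrite inE.
by rewrite -[RHS]h2; apply: eq_bigl => i; rewrite inE.
Qed.

Lemma sin_upper i : tau i <= pi -> 0 <= sin (tau i).
Proof. by move=> h; apply: sin_ge0_pi; rewrite h andbT; case/andP: (tau_itv i). Qed.

Lemma sin_lower i : pi < tau i -> sin (tau i) < 0.
Proof.
move=> h; have [h1 h2] := andP (tau_itv i).
rewrite -[tau i](subrK pi) sinDpi oppr_lt0 sin_gt0_pi//; lra.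
Qed.

Lemma sin0_small : (forall i, sin (tau i) = 0) -> (#|T| <= 2)%N.
Proof.
move=> s0; rewrite -card_bool; apply: (@leq_card _ _ (fun i => tau i == 0)) => i j.
have t k : tau k = 0 \/ tau k = pi.
  have [k0 k2] := andP (tau_itv k).
  have [kp|kp|->] := ltgtP (tau k) pi; last by right.
    left; apply/eqP; rewrite eq_le k0 andbT leNgt; apply/negP => kp0.
    by have := @sin_gt0_pi R (tau k); rewrite s0 kp kp0 ltxx => /(_ isT).
  by have := sin_lower kp; rewrite s0 ltxx.
have pn0 : (pi : R) == 0 = false by rewrite gt_eqF// pi_gt0.
by case: (t i) (t j) => E [] E'; rewrite E E' ?eqxx ?pn0 // => _; apply: tau_inj; rewrite E E'.
Qed.

Hypothesis card_T : (3 < #|T|)%N.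

(** Otherwise all directions would lie in one closed half-plane; as they
    balance they would lie on its boundary line, which contains two directions only. *)
Lemma exists_upper : exists i, 0 < tau i < pi.
Proof.
apply: contrapT => no; suff : (#|T| <= 2)%N by rewrite leqNgt ltnW.
apply: sin0_small => i; apply: null_lower m_sumT _ _ _; rewrite ?inE// => j _.
have [j0 j2] := andP (tau_itv j).
have [jp|jp|->] := ltgtP (tau j) pi; last by rewrite sinpi.
  have [<-|jn] := eqVneq 0 (tau j); first by rewrite sin0.
  by exfalso; apply: no; exists j; rewrite jp lt_neqAle jn j0.
by apply: ltW; apply: sin_lower.
Qed.

Lemma exists_lower : exists i, pi < tau i.
Proof.
apply: contrapT => no; suff : (#|T| <= 2)%N by rewrite leqNgt ltnW.
apply: sin0_small => i; apply: null_upper m_sumT _ _ _; rewrite ?inE// => j _.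
by apply: sin_upper; rewrite leNgt; apply/negP => jp; apply: no; exists j.
Qed.

Let sm i := below tau m i.
Let sp i := below tau m i + m i.
Let H i j := incr_gram (2 * p) sp sm i j / (len i * len j).

Lemma gramC i j : H i j = H j i.
Proof. by rewrite /H incr_gramC (mulrC (len i)). Qed.

Lemma gram_quad x : \sum_i \sum_j x i * x j * H i j =
  \sum_i \sum_j (x i / len i) * (x j / len j) * incr_gram (2 * p) sp sm i j.
Proof.
apply: eq_bigr => i _; apply: eq_bigr => j _; rewrite /H invfM; ring.
Qed.

Lemma gram_ge0 x : 0 <= \sum_i \sum_j x i * x j * H i j.
Proof. by rewrite gram_quad incr_gram_ge0. Qed.

Lemma gram1 i : H i i = 1.
Proof.
rewrite /H -expr2 len_sqr /incr_gram !subrr normr0 powR0// /sp /sm.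
rewrite (_ : _ + m i - _ = m i); last by ring.
rewrite distrC (_ : _ + m i - _ = m i); last by ring.
have : `|m i| `^ (2 * p) != 0 by rewrite -len_sqr expf_neq0// gt_eqF.
by move: (_ `^ _) => A A0; field.
Qed.

(** The inequality for the pair i, j bounds the third side of the planar triangle
    by the third side |m i + m j|^p of the triangle of the fractional Brownian
    motion; the other two sides have the same lengths. *)
Lemma gram_adjacent i j : i != j -> sm j = sp i -> cos (tau j - tau i) <= H i j.
Proof.
move=> ij E; rewrite /H ler_pdivlMr ?mulr_gt0//.
have := sub_le [set i; j]%SET.
have ij' : i \notin [set j]%SET by rewrite inE.
rewrite !big_setU1 //= !big_set1 => h.
rewrite /incr_gram -E subrr normr0 powR0//.
rewrite (_ : sm i - sp j = - (m i + m j)); last first.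
  by rewrite /sp -/(sm j) E /sp /sm; ring.
rewrite (_ : sm j - sp j = - m j); last by rewrite /sp /sm; ring.
rewrite (_ : sm i - sm j = - m i); last by rewrite E /sp /sm; ring.
rewrite !normrN -!len_sqr cosB.
have c1 := cos2Dsin2 (tau i); have c2 := cos2Dsin2 (tau j).
move: h; rewrite (_ : _ + _ = len i ^+ 2 * (cos (tau i) ^+ 2 + sin (tau i) ^+ 2) +
   len j ^+ 2 * (cos (tau j) ^+ 2 + sin (tau j) ^+ 2) + 2 * ((cos (tau j) * cos (tau i) + sin (tau j) * sin (tau i)) * (len i * len j))); last by ring.
by rewrite c1 c2; lra.
Qed.

Lemma gram_next i j : tau i < tau j ->
  (forall k, tau i < tau k -> tau j <= tau k) -> cos (tau j - tau i) <= H i j.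
Proof.
move=> ij nx; apply: gram_adjacent.
  by apply: contraTneq ij => ->; rewrite ltxx.
rewrite /sm /sp /below (bigD1 i) //= addrC; congr (_ + _); apply: eq_bigl => k.
apply/andP/idP => [[kj ki]|ki]; last first.
  by split; [exact: lt_trans ij|apply: contraTneq ki => ->; rewrite ltxx].
rewrite lt_neqAle (inj_eq tau_inj) ki leNgt; apply/negP => /nx.
by rewrite leNgt kj.
Qed.

Lemma sp_last i : (forall k, tau k <= tau i) -> sp i = 0.
Proof.
move=> imax; rewrite -[RHS]m_sum (bigD1 i) //= addrC; congr (_ + _).
by apply: eq_bigl => k; rewrite lt_neqAle imax andbT (inj_eq tau_inj).
Qed.

Lemma sm_first : sm o = 0.
Proof.
by rewrite /sm /below big_pred0 // => k; rewrite tau0 ltNge; case/andP: (tau_itv k) => ->.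
Qed.

(** The total mass is 0, so the last step ends where the first one starts. *)
Lemma gram_last i : (forall k, tau k <= tau i) -> cos (2 * pi - tau i) <= H i o.
Proof.
move=> imax.
have -> : cos (2 * pi - tau i) = cos (tau o - tau i).
  by rewrite tau0 sub0r mulr_natl addrC cosD2pi.
have [->|io] := eqVneq i o; first by rewrite gram1 subrr cos0.
by apply: gram_adjacent; rewrite // sm_first sp_last.
Qed.

(** The steps join 0 to the total mass, which is 0. *)
Lemma gram_closed j : \sum_i len i * H i j = 0.
Proof.
have L : len j != 0 by rewrite gt_eqF.
pose f x := `|x - sm j| `^ (2 * p) - `|x - sp j| `^ (2 * p).
have -> : \sum_i len i * H i j = (2 * len j)^-1 * \sum_i (f (below tau m i + m i) - f (below tau m i)).
  rewrite mulr_sumr; apply: eq_bigr => i _.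
  have Li : len i != 0 by rewrite gt_eqF.
  rewrite /H /incr_gram /f -/(sp i) -/(sm i).
  by field; rewrite L Li.
by rewrite below_telescope // m_sum subrr mulr0.
Qed.

(** Here a and b are the last direction up to pi and the first one after it. The
    relation between the sides o, a and b says that the point masses at the
    ends of these three steps cancel. The end m o of the step o can only be
    cancelled at the start of step a, so that the edges strictly between o and
    a have total mass 0; balancing on their own while lying in an open
    half-plane, they do not exist. Likewise for the edges after b. *)
Lemma polar_contradiction : False.
Proof.
have pp := pi_gt0 R.
have [u /andP[u0 up]] := exists_upper.
have [w wp] := exists_lower.
case: (@Order.TotalTheory.arg_maxP _ R T u (fun i => tau i <= pi) tau (ltW up)) => a ap amax.
case: (@Order.TotalTheory.arg_minP _ R T w (fun i => pi < tau i) tau wp) => b bp bmin.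
have a_max i : tau i <= pi -> tau i <= tau a by exact: amax.
have b_min i : pi < tau i -> tau b <= tau i by exact: bmin.
have [b0 b2] := andP (tau_itv b).
have a0 : 0 < tau a by apply: lt_le_trans u0 _; exact: a_max (ltW up).
have ab : tau b - tau a < pi.
  rewrite ltNge; apply/negP => ab.
  (* otherwise all directions would lie in the half-plane to one side of a, with o in its interior *)
  have [sc ss] := sum_polar.
  have : \sum_i len i * sin (tau a - tau i) = 0.
    rewrite (eq_bigr (fun i => sin (tau a) * (len i * cos (tau i)) - cos (tau a) * (len i * sin (tau i)))).
      by rewrite sumrB -!mulr_sumr sc ss !mulr0 subrr.
    by move=> i _; rewrite sinB; ring.
  move=> /eqP; rewrite psumr_eq0 => [/allP /(_ o (mem_index_enum _))|i _].
    rewrite /= mulf_eq0 gt_eqF//= tau0 subr0 gt_eqF// sin_gt0_pi// a0 /=; lra.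
  have [i0 i2] := andP (tau_itv i).
  rewrite mulr_ge0 ?(ltW (len_gt0 _))//.
  have [ip|ip] := leP (tau i) pi.
    by have := a_max _ ip; move=> ?; apply: sin_ge0_pi; lra.
  have := b_min _ ip => bi.
  rewrite (_ : tau a - tau i = - ((tau i - tau a - pi) + pi)); last by ring.
  by rewrite sinN sinDpi opprK; apply: sin_ge0_pi; lra.
have [x2 [x3 [x20 x30 M0]]] := closed_polygon_isotropic gramC gram_ge0 gram1 tau0 tau_itv
  tau_inj gram_next gram_last ap a_max bp b_min ab len_gt0 gram_closed.
have sab : sm b = sp a.
  rewrite /sm /sp /below (bigD1 a) //=; last by lra.
  rewrite addrC; congr (_ + _); apply: eq_bigl => k.
  apply/andP/idP => [[kb ka]|ka]; last first.
    by split; [lra|apply: contraTneq ka => ->; rewrite ltxx].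
  rewrite lt_neqAle (inj_eq tau_inj) ka /=; apply: a_max.
  by rewrite leNgt; apply/negP => /b_min; rewrite leNgt kb.
have spo : sp o = m o by rewrite /sp -/(sm o) sm_first add0r.
have ker y : ((m o == y)%:R - (0 == y)%:R) / len o + x2 / len a * ((sp a == y)%:R - (sm a == y)%:R)
    + x3 / len b * ((sp b == y)%:R - (sp a == y)%:R) = 0.
  have /(incr_gram_kernel q02) /(_ y) h := etrans (esym (gram_quad _)) M0.
  rewrite -[RHS]h -sab -spo -[0 in LHS]sm_first /opposite_vec.
  have su c (F : T -> R) : \sum_i unitv R c i * F i = F c.
    rewrite (bigD1 c) //= big1 ?addr0 => [|k kc]; first by rewrite /unitv eqxx mul1r.
    by rewrite /unitv (negbTE kc) mul0r.
  pose F i : R := ((sp i == y)%:R - (sm i == y)%:R) / len i.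
  rewrite (eq_bigr (fun i => unitv R o i * F i + x2 * (unitv R a i * F i) + x3 * (unitv R b i * F i))).
    by rewrite !big_split -!mulr_sumr /= !su /F sab; ring.
  by move=> i _; rewrite /F; ring.
have lo : 0 < (len o)^-1 by rewrite invr_gt0.
have la : 0 <= x2 / len a by rewrite divr_ge0// ltW.
have lb : 0 <= x3 / len b by rewrite divr_ge0// ltW.
have b01 (c : bool) : 0 <= (c%:R : R) <= 1 by case: c; rewrite /= ?lexx ?ler01.
have spaE : sp a = \sum_(i | tau i <= pi) m i.
  rewrite /sp /below [RHS](bigD1 a) //= addrC; congr (_ + _); apply: eq_bigl => k.
  apply/idP/andP => [ka|[kp ka]]; last by rewrite lt_neqAle (inj_eq tau_inj) ka a_max.
  by split; [lra|apply: contraTneq ka => ->; rewrite ltxx].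
have drop_o (P : pred T) : P o -> \sum_(i | P i) m i = m o + \sum_(i in [set i | P i & 0 < tau i]%SET) m i.
  move=> Po; rewrite (bigD1 o) //=; congr (_ + _); apply: eq_bigl => k; rewrite inE; congr (_ && _).
  by rewrite -(inj_eq tau_inj) tau0 lt0r; case/andP: (tau_itv k) => ->; rewrite andbT.
have sin_D (D : {set T}) : \sum_(i in D) m i = 0 ->
    (forall i, i \in D -> 0 < tau i <= pi) -> forall i, i \in D -> tau i = pi.
  move=> D0 Dp i iD; have := null_upper D0 (fun j jD => sin_upper (andP (Dp j jD)).2) iD.
  have /andP[i0] := Dp i iD; rewrite le_eqVlt => /orP[/eqP//|ip].
  by move=> si; have := @sin_gt0_pi R (tau i); rewrite si i0 ip ltxx => /(_ isT).
have sin_L (D : {set T}) : \sum_(i in D) m i = 0 ->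
    (forall i, i \in D -> pi < tau i) -> forall i, i \notin D.
  move=> D0 Dp i; apply/negP => iD.
  have := null_lower D0 (fun j jD => ltW (sin_lower (Dp j jD))) iD.
  by move=> E; have := sin_lower (Dp i iD); rewrite E ltxx.
(* all edges after pi would balance on their own *)
have spa0 : sp a != 0.
  apply/eqP; rewrite spaE => E.
  have D0 : \sum_(i in [set i | pi < tau i]%SET) m i = 0.
    move: m_sum; rewrite (bigID (fun i => tau i <= pi)) /= E add0r => h; rewrite -[RHS]h.
    by apply: eq_bigl => i; rewrite inE ltNge.
  by have := sin_L _ D0 _ w; rewrite !inE wp => h; suff: ~~ true by []; apply: h => i; rewrite inE.
(* the edges after o up to pi would balance on their own *)
have spao : sp a != m o.
  apply/eqP; rewrite spaE (drop_o (fun i => tau i <= pi)) ?tau0 ?ltW// => /eqP.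
  rewrite addrC -subr_eq0 addrK => /eqP /sin_D h.
  suff : tau u = pi by lra.
  by apply: h => [i|]; rewrite inE; [case/andP=> -> ->|rewrite u0 ltW].
have sma : sm a = m o.
  apply/eqP/negPn/negP => ne; have := ker (m o).
  rewrite eqxx (negbTE ne) (negbTE spao) eq_sym (negbTE (m_neq0 o)) !subr0 mulr0 addr0 mul1r.
  have := mulr_ge0 lb (andP (b01 (sp b == m o))).1; lra.
have spb : sp b = 0.
  apply/eqP/negPn/negP => ne; have := ker 0.
  rewrite eqxx (negbTE ne) (negbTE spa0) (negbTE (m_neq0 o)) !sub0r !oppr0 mulr0 addr0.
  have := mulr_ge0 la (andP (b01 (sm a == 0))).1; rewrite /= ?mulr1n; lra.
have up_a i : 0 < tau i -> tau i < tau a -> False.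
  move=> i0 ia; move: sma; rewrite /sm /below (drop_o (fun i => tau i < tau a)) ?tau0// => /eqP.
  rewrite addrC -subr_eq0 addrK => /eqP /sin_D h.
  suff : tau i = pi by lra.
  by apply: h => [j|]; rewrite inE; [case/andP=> ? ->; lra|rewrite ia].
have low_b i : tau b < tau i -> False.
  move=> bi.
  have D0 : \sum_(i in [set i | tau b < tau i]%SET) m i = 0.
    move: m_sum; rewrite (bigID (fun i => tau i <= tau b)) /= (bigD1 b) //=.
    rewrite [X in _ + X + _](_ : _ = below tau m b); last first.
      by apply: eq_bigl => k; rewrite lt_neqAle (inj_eq tau_inj) andbC.
    rewrite (addrC (m b)) -/(sp b) spb add0r => h; rewrite -[RHS]h.
    by apply: eq_bigl => k; rewrite inE ltNge.
  have := sin_L _ D0 _ i; rewrite inE bi => h; suff: ~~ true by [].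
  by apply: h => k; rewrite inE; lra.
have all3 i : i \in [:: o; a; b].
  rewrite !inE -!(inj_eq tau_inj) tau0.
  have [i0 i2] := andP (tau_itv i).
  have [ip|ip] := leP (tau i) pi.
    have := a_max _ ip; rewrite le_eqVlt => /orP[->|ia]; first by rewrite orbT.
    by move: i0; rewrite le_eqVlt eq_sym => /orP[->//|/up_a /(_ ia)].
  have := b_min _ ip; rewrite le_eqVlt eq_sym => /orP[->|/low_b//]; first by rewrite !orbT.
have := card_size [:: o; a; b].
rewrite (@eq_card _ _ (mem T)) => [|i]; last by rewrite all3.
by rewrite leqNgt card_T.
Qed.

End polar.

Lemma polar_angle (R : realType) (x y : R) : x ^+ 2 + y ^+ 2 = 1 ->
  exists t, [/\ 0 <= t < 2 * pi, cos t = x & sin t = y].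
Proof.
move=> xy.
have x1 : -1 <= x <= 1 by have := sqr_ge0 y; move=> ?; apply/andP; split; nra.
have a0 := acos_ge0 x1; have ap := acos_lepi x1; have pp := pi_gt0 R.
have ca : cos (acos x) = x by rewrite acosK.
have sa : sin (acos x) = `|y|.
  by rewrite sin_acos // -sqrtr_sqr -xy; congr Num.sqrt; ring.
have [y0|y0] := leP 0 y.
  by exists (acos x); rewrite ca sa ger0_norm// a0; split => //; lra.
exists (2 * pi - acos x).
rewrite mulr_natl addrC cosD2pi sinD2pi cosN sinN ca sa ltr0_norm // opprK.
split => //; apply/andP; split; first by rewrite mulr2n; lra.
suff : 0 < acos x by rewrite mulr2n; lra.
rewrite lt0r a0 andbT; apply/negP => /eqP E.
by move: sa; rewrite E sin0 => /esym/eqP; rewrite normr_eq0 => /eqP h; move: y0; rewrite h ltxx.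
Qed.

(** This is what prevents two edges at v from having the same direction. *)
Lemma powR_strict_subadditive (R : realType) (p x y : R) : 0 < p < 1 -> x != 0 -> y != 0 ->
  `|x + y| `^ p < `|x| `^ p + `|y| `^ p.
Proof.
move=> /andP[p0 p1] x0 y0.
have x1 : 0 < `|x| by rewrite normr_gt0.
have y1 : 0 < `|y| by rewrite normr_gt0.
set s := `|x| + `|y|; have s0 : 0 < s by exact: addr_gt0.
apply: (@le_lt_trans _ _ (s `^ p)).
  by apply: ge0_ler_powR; rewrite ?nnegrE ?(ltW p0) ?(ltW s0) ?normr_ge0 ?ler_normD.
have E z : 0 < z -> z `^ p = z / z `^ (1 - p).
  move=> z0; rewrite -{2}(powRr1 (ltW z0)) -powRN -powRD ?(gt_eqF z0) ?implybT//.
  by congr (_ `^ _); ring.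
have L z : 0 < z -> z < s -> z / s `^ (1 - p) < z `^ p.
  move=> z0 zs; rewrite (E z)// ltr_pM2l// ltf_pV2 ?posrE ?powR_gt0//.
  by apply: gt0_ltr_powR; rewrite ?nnegrE ?(ltW z0) ?(ltW s0) ?subr_gt0.
rewrite (E s)// {1}/s mulrDl; apply: ltrD; apply: L => //; by rewrite /s ?ltrDl ?ltrDr.
Qed.

(** Choosing one vector as the origin of the angles reduces this to
    [polar_contradiction]; the angles are distinct by strict subadditivity. *)
Theorem balanced_star_card_le3 (R : realType) (T : finType) (p : R) (m : T -> R) (z : T -> R * R) :
  0 < p < 1 -> (forall i, m i != 0) -> \sum_i m i = 0 ->
  (forall i, (z i).1 ^+ 2 + (z i).2 ^+ 2 = `|m i| `^ (2 * p)) ->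
  (forall D : {set T}, (\sum_(i in D) (z i).1) ^+ 2 + (\sum_(i in D) (z i).2) ^+ 2
     <= `|\sum_(i in D) m i| `^ (2 * p)) ->
  (#|T| <= 3)%N.
Proof.
move=> p01 m0 msum zn zsub; rewrite leqNgt; apply/negP => T4.
have [ o _] : exists o : T, o \in T by apply/card_gt0P; apply: leq_trans T4.
pose len i := `|m i| `^ p.
have len0 i : 0 < len i by rewrite powR_gt0 ?normr_gt0.
have len2 i : len i ^+ 2 = `|m i| `^ (2 * p).
  by rewrite -powR_mulrn ?powR_ge0// -powRrM mulrC.
pose u i := ((z i).1 / len i, (z i).2 / len i).
have u1 i : (u i).1 ^+ 2 + (u i).2 ^+ 2 = 1.
  rewrite /u /= !exprMn -mulrDl zn -len2 exprVn divff// expf_neq0// gt_eqF//.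
pose X i := (u o).1 * (u i).1 + (u o).2 * (u i).2.
pose Y i := (u o).1 * (u i).2 - (u o).2 * (u i).1.
have XY i : X i ^+ 2 + Y i ^+ 2 = 1.
  transitivity (((u o).1 ^+ 2 + (u o).2 ^+ 2) * ((u i).1 ^+ 2 + (u i).2 ^+ 2)).
    by rewrite /X /Y; ring.
  by rewrite !u1 mulr1.
have Xo : X o = 1 by rewrite -(u1 o) /X !expr2.
have Yo : Y o = 0 by rewrite /Y; ring.
pose ang (i : T) t := [/\ 0 <= t < 2 * pi, cos t = X i, sin t = Y i & i = o -> t = 0].
have /choice[tau tauP] : forall i, exists t : R, ang i t.
  move=> i; have [->|io] := eqVneq i o.
    by exists 0; split; rewrite ?cos0 ?sin0 ?lexx ?mulr_gt0 ?pi_gt0.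
  have [t [t1 t2 t3]] := polar_angle (XY i).
  by exists t; split => // E; rewrite E eqxx in io.
have tau_inj : injective tau.
  move=> i j ij; apply/eqP/negPn/negP => ne.
  have [_ ci si _] := tauP i; have [_ cj sj _] := tauP j.
  have EX : X i = X j by rewrite -ci -cj ij.
  have EY : Y i = Y j by rewrite -si -sj ij.
  have e1 : (u i).1 = (u j).1.
    have U k : (u k).1 = (u o).1 * X k - (u o).2 * Y k.
      rewrite (_ : _ - _ = ((u o).1 ^+ 2 + (u o).2 ^+ 2) * (u k).1); last by rewrite /X /Y; ring.
      by rewrite u1 mul1r.
    by rewrite U EX EY -U.
  have e2 : (u i).2 = (u j).2.
    have U k : (u k).2 = (u o).2 * X k + (u o).1 * Y k.
      rewrite (_ : _ * X k + _ = ((u o).1 ^+ 2 + (u o).2 ^+ 2) * (u k).2); last by rewrite /X /Y; ring.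
      by rewrite u1 mul1r.
    by rewrite U EX EY -U.
  have z1 k : (z k).1 = len k * (u k).1 by rewrite /u /= mulrC divfK // gt_eqF.
  have z2 k : (z k).2 = len k * (u k).2 by rewrite /u /= mulrC divfK // gt_eqF.
  have := zsub [set i; j]%SET.
  have ij' : i \notin [set j]%SET by rewrite inE.
  rewrite !big_setU1 //= !big_set1 !z1 !z2 e1 e2.
  rewrite (_ : _ + _ = (len i + len j) ^+ 2 * ((u j).1 ^+ 2 + (u j).2 ^+ 2)); last by ring.
  rewrite u1 mulr1 (mulrC 2) powRrM powR_mulrn ?powR_ge0//.
  rewrite ler_sqr ?nnegrE ?powR_ge0 ?addr_ge0 ?(ltW (len0 _))//.
  by rewrite leNgt powR_strict_subadditive.
apply: (@polar_contradiction R T m tau p o) => //.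
- by have [_ _ _ ->] := tauP o.
- by move=> i; have [] := tauP i.
- move=> D; apply: le_trans (zsub D).
  have E1 : \sum_(i in D) len i * cos (tau i) =
     (u o).1 * \sum_(i in D) (z i).1 + (u o).2 * \sum_(i in D) (z i).2.
    rewrite !mulr_sumr -big_split; apply: eq_bigr => i _ /=.
    have [_ -> _ _] := tauP i; rewrite /X /u /=; field.
    by rewrite !gt_eqF.
  have E2 : \sum_(i in D) len i * sin (tau i) =
     (u o).1 * \sum_(i in D) (z i).2 - (u o).2 * \sum_(i in D) (z i).1.
    rewrite !mulr_sumr -sumrB; apply: eq_bigr => i _ /=.
    have [_ _ -> _] := tauP i; rewrite /Y /u /=; field.
    by rewrite !gt_eqF.
  rewrite -/len E1 E2; move: (\sum_(i in D) (z i).1) (\sum_(i in D) (z i).2) => a b.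
  rewrite le_eqVlt; apply/orP; left; apply/eqP.
  rewrite (_ : _ + _ = ((u o).1 ^+ 2 + (u o).2 ^+ 2) * (a ^+ 2 + b ^+ 2)); last by ring.
  by rewrite u1 mul1r.
Qed.

(** * Splitting a vertex of a flow *)

Lemma big_fsetU_disjoint (Z : nmodType) (K : choiceType) (A B : {fset K}) (f : K -> Z) :
  (forall x, x \in A -> x \notin B) ->
  \sum_(x <- (A `|` B)%fset) f x = \sum_(x <- A) f x + \sum_(x <- B) f x.
Proof.
move=> AB; rewrite (big_fsetID _ (mem A)) /=; congr (_ + _); apply: eq_fbigl => x; rewrite !inE.
  by case: (x \in A); rewrite ?andbT ?andbF.
by have [/AB/negbTE->|] := boolP (x \in A); rewrite ?andbT ?andbF.
Qed.

Section edges.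
Variable R : realType.
Implicit Types (x y v w : plane R) (E : {fset {fset plane R}}) (S : {fset plane R}).

Lemma fset2_eq x y w t : x != y -> w != t -> [fset x; y]%fset = [fset w; t]%fset ->
  (x = w /\ y = t) \/ (x = t /\ y = w).
Proof.
move=> xy wt E.
have : x \in [fset w; t]%fset by rewrite -E fset21.
have : y \in [fset w; t]%fset by rewrite -E fset22.
rewrite !in_fset2 => /orP[] /eqP Ey /orP[] /eqP Ex; subst; rewrite ?eqxx // in xy *; [right|left] => //.
Qed.

Lemma edge_val_ext (Z : Type) (f g : plane R -> plane R -> Z) x y : x != y ->
  (forall a b, a \in [fset x; y]%fset -> b \in [fset x; y]%fset -> f a b = g a b) ->
  edge_val f [fset x; y]%fset = edge_val g [fset x; y]%fset.
Proof.
move=> xy fg; rewrite /edge_val.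
have c2 : size (enum_fset [fset x; y]%fset) = 2 by rewrite -[LHS]/(#|` _|) cardfs2 xy.
by apply: fg; rewrite -[_ \in _]/(_ \in enum_fset [fset x; y]%fset) mem_nth // c2.
Qed.

Definition star v S : {fset {fset plane R}} := [fset [fset v; x]%fset | x in S]%fset.

Lemma starP v S e : reflect (exists2 x, x \in S & e = [fset v; x]%fset) (e \in star v S).
Proof. exact: imfsetP. Qed.

Lemma edge_sum_star (Z : nmodType) (f : plane R -> plane R -> Z) v S :
  v \notin S -> (forall x, x \in S -> f v x = f x v) ->
  edge_sum (star v S) f = \sum_(x <- S) f v x.
Proof.
move=> vS fC; have vx x : x \in S -> v != x by apply: contraTneq => <-.
rewrite /edge_sum big_imfset /= => [|x y xS yS E]; last first.
  by have [[]//|[yv xv]] := fset2_eq (vx _ xS) (vx _ yS) E; rewrite xv yv.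
rewrite big_seq [RHS]big_seq; apply: eq_bigr => x xS.
by rewrite edge_valE ?vx// fC.
Qed.

Lemma edge_sum_diff (Z : nmodType) (f : plane R -> plane R -> Z) E E' :
  (E' `<=` E)%fset -> edge_sum E f = edge_sum (E `\` E')%fset f + edge_sum E' f.
Proof.
move=> /fsubsetP EE'; rewrite /edge_sum -big_fsetU_disjoint => [|e]; last by rewrite inE => /andP[].
apply: eq_fbigl => e; rewrite !inE.
by have [/EE' ->|_] := boolP (e \in E'); rewrite ?orbF.
Qed.

Lemma edge_sumU (Z : nmodType) (f : plane R -> plane R -> Z) E E' :
  (forall e, e \in E -> e \notin E') ->
  edge_sum (E `|` E')%fset f = edge_sum E f + edge_sum E' f.
Proof. exact: big_fsetU_disjoint. Qed.

Lemma edge_sum_EFin (f : plane R -> plane R -> R) E :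
  edge_sum E (fun x y => (f x y)%:E) = (edge_sum E f)%:E.
Proof. by rewrite /edge_sum -sumEFin. Qed.

End edges.

Section split.
Variables (R : realType) (mup mum : {finite_measure set (plane R) -> \bar R}).
Variable F : flow mup mum.
Let V := flow_vertices F.
Let E := flow_edges F.
Let m := flow_mass F.

Lemma edge_ends x y : [fset x; y]%fset \in E -> [/\ x \in V, y \in V & x != y].
Proof.
move=> /flow_edgesP[a [b [aV bV ab e]]].
have xe : x \in [fset a; b]%fset by rewrite -e fset21.
have ye : y \in [fset a; b]%fset by rewrite -e fset22.
split.
- by move: xe; rewrite in_fset2 => /orP[] /eqP ->.
- by move: ye; rewrite in_fset2 => /orP[] /eqP ->.
- apply/eqP => xy; have : #|` [fset x; y]%fset| = #|` [fset a; b]%fset| by rewrite e.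
  by rewrite !cardfs2 xy eqxx ab.
Qed.

Variables (v w : plane R) (I : {fset plane R}).
Hypothesis IE : forall x, x \in I -> [fset v; x]%fset \in E.
Hypothesis vV : v \in V.
Hypothesis wV : w \notin V.

Let M : R := \sum_(x <- I) m v x.
(* the neighbours of w: an edge of mass 0 is not allowed *)
Let J := if M == 0 then I else (v |` I)%fset.

(** The masses after the edges from v to the points of I have been moved to
    w; the edge from v to w carries their sum M. Every other mass is kept. *)
Definition split_mass (a b : plane R) : R :=
  if a == w then (if b == v then - M else m v b)
  else if b == w then (if a == v then M else m a v) else m a b.

Let split_edges := ((E `\` star v I) `|` star w J)%fset.

Let vI : v \notin I.
Proof. by apply/negP => /IE /edge_ends[_ _]; rewrite eqxx. Qed.

Let JP x : x \in J -> x \in I \/ (x = v /\ M != 0).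
Proof.
rewrite /J; case: (eqVneq M 0) => [_|M0]; first by left.
by rewrite !inE => /orP[/eqP ->|]; [right|left].
Qed.

Let JV x : x \in J -> x \in V.
Proof. by move=> /JP[/IE /edge_ends[]//|[->]]. Qed.

Let wx x : x \in V -> w != x.
Proof. by move=> xV; apply: contraNneq wV => ->. Qed.

Let wJ : w \notin J.
Proof. by apply/negP => /JV; apply/negP. Qed.

Let split_mass_old a b : a \in V -> b \in V -> split_mass a b = m a b.
Proof.
by move=> aV bV; rewrite /split_mass (eq_sym a) (negbTE (wx aV)) (eq_sym b) (negbTE (wx bV)).
Qed.

Let split_massC x : x \in J -> split_mass w x + split_mass x w = 0.
Proof.
move=> xJ; rewrite /split_mass eqxx (eq_sym x w) (negbTE (wx (JV xJ))).
have [xI|[-> M0]] := JP xJ; last by rewrite eqxx addNr.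
have xv : x != v by apply: contraTneq xI => ->.
by rewrite (negbTE xv) flow_massC // IE.
Qed.

Let split_edges_cases x y : [fset x; y]%fset \in split_edges ->
  [\/ [fset x; y]%fset \in E, x = w /\ y \in J | y = w /\ x \in J].
Proof.
rewrite inE => /orP[|]; first by rewrite inE => /andP[_ ->]; constructor 1.
case/starP => t tJ e; have xy : x != y.
  apply/eqP => xy; have : #|` [fset x; y]%fset| = #|` [fset w; t]%fset| by rewrite e.
  by rewrite !cardfs2 xy eqxx (wx (JV tJ)).
have [[-> ->]|[-> ->]] := fset2_eq xy (wx (JV tJ)) e; first by constructor 2.
by constructor 3.
Qed.

(** Both edge sums are compared to the sum over the untouched edges, so that
    only the edges at w and the edges that were moved remain to be compared. *)
Lemma split_edge_sum (Z : nmodType) (f g : plane R -> plane R -> Z) :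
  (forall x y, [fset x; y]%fset \in E -> f x y = f y x) ->
  (forall x, x \in J -> g w x = g x w) ->
  (forall a b, a \in V -> b \in V -> f a b = g a b) ->
  exists c, edge_sum E f = c + \sum_(x <- I) f v x /\
            edge_sum split_edges g = c + \sum_(x <- J) g w x.
Proof.
move=> fC gC fg; exists (edge_sum (E `\` star v I)%fset f).
have sub : (star v I `<=` E)%fset.
  by apply/fsubsetP => e /starP[x xI ->]; exact: IE.
rewrite (edge_sum_diff _ sub) edge_sumU; last first.
  move=> e; rewrite inE => /andP[_ eE]; apply/negP => /starP[x _ ee].
  by move: eE; rewrite ee => /edge_ends[wV' _ _]; move: wV; rewrite wV'.
rewrite !edge_sum_star //; last by move=> x /IE /fC.
split => //; congr (_ + _); rewrite /edge_sum big_seq [RHS]big_seq.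
apply: eq_bigr => e; rewrite inE => /andP[_ /flow_edgesP[x [y [xV yV xy ->]]]].
apply: edge_val_ext => // a b; rewrite !in_fset2.
by move=> /orP[] /eqP -> /orP[] /eqP ->; rewrite fg.
Qed.

Lemma big_J (h : plane R -> R) :
  \sum_(x <- J) h x = (if M == 0 then 0 else h v) + \sum_(x <- I) h x.
Proof.
rewrite /J; case: ifP => _; first by rewrite add0r.
by rewrite big_fsetU1.
Qed.

(** The edge from v to w restores at v, and consumes at w, the mass of the moved
    edges. *)
Lemma split_balance A : measurable A -> (mup A - mum A)%E =
  edge_sum split_edges (fun x y => (split_mass x y)%:E * (\d_y A - \d_x A))%E.
Proof.
move=> mA; rewrite (flow_balance F mA).
have E2 (n : plane R -> plane R -> R) : (fun x y => (n x y)%:E * (\d_y A - \d_x A))%E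
    = (fun x y => (n x y * (\1_A y - \1_A x))%:E).
  by apply/funext => x; apply/funext => y; rewrite !diracE !indicE EFinM EFinB.
rewrite !E2 !edge_sum_EFin; congr EFin.
have [||| c [-> ->]] := @split_edge_sum _
  (fun x y => m x y * (\1_A y - \1_A x)) (fun x y => split_mass x y * (\1_A y - \1_A x)).
- move=> x y xyE; have := flow_massC xyE; rewrite -/m.
  by move/eqP; rewrite addr_eq0 => /eqP ->; ring.
- by move=> x /split_massC /eqP; rewrite addr_eq0 => /eqP ->; ring.
- by move=> a b aV bV; rewrite split_mass_old.
congr (_ + _); rewrite big_J (_ : (if _ then _ else _) = - M * (\1_A v - \1_A w)); last first.
  by case: eqP => [->|_]; rewrite ?oppr0 ?mul0r // /split_mass !eqxx.
rewrite /M -sumrN mulr_suml -big_split big_seq [RHS]big_seq /=.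
apply: eq_bigr => x xI; have xv : x != v by apply: contraTneq xI => ->.
by rewrite /split_mass eqxx (negbTE xv) /m; ring.
Qed.

Definition split_flow : flow mup mum.
Proof.
apply: (@Flow _ _ _ (w |` V)%fset split_edges split_mass).
- by move=> x /flow_supp xV; rewrite /= inE xV orbT.
- move=> e; rewrite inE => /orP[|/starP[x xJ ->]].
    rewrite inE => /andP[_ /flow_edgesP[x [y [xV yV xy ->]]]].
    by exists x, y; split => //; rewrite inE ?xV ?yV orbT.
  by exists w, x; split; rewrite ?inE ?eqxx ?(JV xJ) ?orbT// wx// JV.
- have h x : x \in J -> split_mass w x != 0.
    move=> xJ; rewrite /split_mass eqxx; have [xI|[-> M0]] := JP xJ; last by rewrite eqxx oppr_eq0.
    have xv : x != v by apply: contraTneq xI => ->.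
    by rewrite (negbTE xv) flow_mass_neq0 // IE.
  move=> x y /split_edges_cases[xyE|[-> yJ]|[-> xJ]].
  + by have [xV yV _] := edge_ends xyE; rewrite split_mass_old // flow_mass_neq0.
  + exact: h.
  + by have /eqP := split_massC xJ; rewrite addrC addr_eq0 => /eqP ->; rewrite oppr_eq0 h.
- move=> x y /split_edges_cases[xyE|[-> yJ]|[-> xJ]].
  + by have [xV yV _] := edge_ends xyE; rewrite !split_mass_old // flow_massC.
  + exact: split_massC.
  + by rewrite addrC split_massC.
- exact: split_balance.
Defined.

Lemma rhoC (x y : plane R) : rho x y = rho y x.
Proof. by rewrite /rho -sqrrN opprB -[X in _ + X]sqrrN opprB. Qed.

Lemma split_gilbert_le (C : R -> R) : C 0 = 0 ->
  gilbert C F <= gilbert C split_flow ->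
  \sum_(x <- I) C `|m v x| * rho v x <=
  C `|M| * rho w v + \sum_(x <- I) C `|m v x| * rho w x.
Proof.
move=> C0; rewrite /gilbert /=.
have [||| c [-> ->]] := @split_edge_sum _
  (fun x y => C `|m x y| * rho x y) (fun x y => C `|split_mass x y| * rho x y).
- move=> x y xyE; have /eqP := flow_massC xyE; rewrite addr_eq0 => /eqP e.
  by rewrite /m e normrN rhoC.
- by move=> x /split_massC /eqP; rewrite addr_eq0 => /eqP ->; rewrite normrN rhoC.
- by move=> a b aV bV; rewrite split_mass_old.
rewrite lerD2l big_J => /le_trans; apply.
apply: lerD.
  case: eqP => [->|_]; first by rewrite normr0 C0 mul0r.
  by rewrite /split_mass !eqxx normrN.
rewrite big_seq [leRHS]big_seq; apply: ler_sum => x xI.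
have xv : x != v by apply: contraTneq xI => ->.
by rewrite /split_mass eqxx (negbTE xv).
Qed.

End split.

(** * First variation and the degree of a branching point *)

Section variation.
Variable R : realType.
Implicit Types (x v n : plane R).

Definition shift v n (e : R) : plane R := (v.1 + e * n.1, v.2 + e * n.2).

Definition dotp x n : R := x.1 * n.1 + x.2 * n.2.

(** Among the infinitely many points v + (e0 / k) n only finitely many are in V. *)
Lemma shift_avoids (V : {fset plane R}) v n (e0 : R) : n != 0 -> 0 < e0 ->
  exists e, [/\ 0 < e, e <= e0 & shift v n e \notin V].
Proof.
move=> n0 e00; apply: contrapT => no.
pose f (k : nat) := shift v n (e0 / k.+1%:R).
have fV k : f k \in V.
  apply/negPn/negP => fk; apply: no; exists (e0 / k.+1%:R); split => //.
    by rewrite divr_gt0.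
  by rewrite ler_pdivrMr// ler_peMr ?(ltW e00)// ler1n.
have f_inj : injective f.
  move=> i j [] /addrI h1 /addrI h2.
  have : e0 / i.+1%:R = e0 / j.+1%:R.
    have [n1|n1] := eqVneq n.1 0; last exact: (mulIf n1 h1).
    have n2 : n.2 != 0.
      by apply: contraNneq n0 => n2; apply/eqP; rewrite [n]surjective_pairing n1 n2.
    exact: (mulIf n2 h2).
  by move/(mulfI (lt0r_neq0 e00))/invr_inj/eqP; rewrite eqr_nat => /eqP[].
have : uniq [seq f k | k <- iota 0 #|` V|.+1] by rewrite map_inj_uniq ?iota_uniq.
have sub : {subset [seq f k | k <- iota 0 #|` V|.+1] <= enum_fset V}.
  by move=> x /mapP[k _ ->]; exact: fV.
by move=> /uniq_leq_size /(_ sub); rewrite size_map size_iota ltnn.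
Qed.

Lemma rho_gt0 (x y : plane R) : x != y -> 0 < rho x y.
Proof.
move=> xy; rewrite /rho sqrtr_gt0 lt0r addr_ge0 ?sqr_ge0// andbT paddr_eq0 ?sqr_ge0//.
apply: contraNN xy; rewrite !sqrf_eq0 !subr_eq0 => /andP[/eqP x1 /eqP x2].
by rewrite [x]surjective_pairing [y]surjective_pairing x1 x2.
Qed.

Lemma rho_sqr (x y : plane R) : rho x y ^+ 2 = (x.1 - y.1) ^+ 2 + (x.2 - y.2) ^+ 2.
Proof. by rewrite sqr_sqrtr // addr_ge0 ?sqr_ge0. Qed.

Lemma rho_shift v n (e : R) : 0 < e -> rho (shift v n e) v = e * Num.sqrt (dotp n n).
Proof.
move=> e0; rewrite /rho /shift /dotp /=.
rewrite (_ : _ + _ = e ^+ 2 * (n.1 * n.1 + n.2 * n.2)); last by ring.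
by rewrite sqrtrM ?sqr_ge0// sqrtr_sqr gtr0_norm.
Qed.

(** The bound y <= (y^2 + d^2) / (2 d) for the new distance y in terms of the
    old one, d, is exact to first order and needs no differentiation. *)
Lemma rho_shift_le x v n (e : R) : x != v ->
  rho (shift v n e) x <=
  rho v x - e * (dotp n (x - v) / rho v x) + e ^+ 2 * (dotp n n / (2 * rho v x)).
Proof.
move=> xv; have d0 : 0 < rho v x by rewrite rho_gt0// eq_sym.
have key (y d : R) : 0 < d -> y <= (y ^+ 2 + d ^+ 2) / (2 * d).
  by move=> d1; rewrite ler_pdivlMr ?mulr_gt0//; have := sqr_ge0 (y - d); lra.
apply: le_trans (key _ _ d0) _; rewrite rho_sqr /shift /dotp /=.
have := rho_sqr v x; move: (rho v x) d0 => d d0 E.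
rewrite [leRHS](_ : _ = (2 * d ^+ 2 - 2 * e * (n.1 * (x.1 - v.1) + n.2 * (x.2 - v.2)) +
  e ^+ 2 * (n.1 * n.1 + n.2 * n.2)) / (2 * d)); last by field; rewrite gt_eqF.
by rewrite ler_pM2r ?invr_gt0 ?mulr_gt0//; lra.
Qed.

Lemma first_order_ge0 (V : {fset plane R}) v n (K C : R) : n != 0 ->
  (forall e, 0 < e -> shift v n e \notin V -> 0 <= e * K + e ^+ 2 * C) -> 0 <= K.
Proof.
move=> n0 h; rewrite leNgt; apply/negP => K0.
have C1 : 0 < `|C| + 1 by have := normr_ge0 C; lra.
have e00 : 0 < - K / (`|C| + 1) by rewrite divr_gt0 // oppr_gt0.
have [e [e0 ee eV]] := shift_avoids V v n0 e00.
have := h e e0 eV; rewrite expr2 -mulrA -mulrDr pmulr_rge0//.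
move: ee; rewrite ler_pdivlMr// => ee.
have : e * C <= e * `|C| by rewrite ler_pM2l // ler_norm.
lra.
Qed.

End variation.

Lemma measurable_plane_set1 (R : realType) (v : plane R) : measurable [set v].
Proof.
rewrite (_ : [set v] = [set v.1] `*` [set v.2]); last first.
  apply/seteqP; split => [x /= ->//|[a b] /= [-> ->]]; exact/esym/surjective_pairing.
exact: measurableX.
Qed.

Section optimal.
Variables (R : realType) (mup mum : {finite_measure set (plane R) -> \bar R}) (p : R).
Hypothesis p01 : 0 < p < 1.
Variable F : flow mup mum.
Hypothesis F_min : forall G : flow mup mum,
  gilbert (fun t => t `^ p) F <= gilbert (fun t => t `^ p) G.
Variable v : plane R.
Hypothesis vV : v \in flow_vertices F.
Let m := flow_mass F.

Let p_neq0 : p != 0.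
Proof. by case/andP: p01 => ? _; rewrite gt_eqF. Qed.

(** The cost of the competing flow with new vertex w = v + e n changes by
    e (|M|^p |n| - sum of |m|^p times the cosines) + O(e^2). *)
Lemma first_variation (I : {fset plane R}) n :
  (forall x, x \in I -> [fset v; x]%fset \in flow_edges F) -> n != 0 ->
  \sum_(x <- I) `|m v x| `^ p * (dotp n (x - v) / rho v x)
    <= `|\sum_(x <- I) m v x| `^ p * Num.sqrt (dotp n n).
Proof.
move=> IE n0; set M := \sum_(x <- I) m v x.
rewrite -subr_ge0.
apply: (@first_order_ge0 _ (flow_vertices F) v n _
  (\sum_(x <- I) `|m v x| `^ p * (dotp n n / (2 * rho v x)))) => // e e0 wV.
have := split_gilbert_le (powR0 p_neq0) (F_min (split_flow IE vV wV)).
rewrite -/M rho_shift// => le.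
have {}le : \sum_(x <- I) `|m v x| `^ p * rho v x <=
    `|M| `^ p * (e * Num.sqrt (dotp n n)) +
    (\sum_(x <- I) `|m v x| `^ p * rho v x
     - e * (\sum_(x <- I) `|m v x| `^ p * (dotp n (x - v) / rho v x))
     + e ^+ 2 * \sum_(x <- I) `|m v x| `^ p * (dotp n n / (2 * rho v x))).
  apply: le_trans le _; rewrite lerD2l !mulr_sumr -sumrB -big_split /=.
  rewrite big_seq [leRHS]big_seq; apply: ler_sum => x xI.
  have xv : x != v by have [_ _] := edge_ends (IE _ xI); rewrite eq_sym.
  have := ler_wpM2l (powR_ge0 `|m v x| p) (rho_shift_le n e xv).
  by move/le_trans; apply; rewrite le_eqVlt; apply/orP; left; apply/eqP; ring.
by move: le; rewrite -/m; lra.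
Qed.

Let N := [fset x in flow_vertices F | [fset v; x]%fset \in flow_edges F]%fset.

Lemma neighbour_edge x : x \in N -> [fset v; x]%fset \in flow_edges F.
Proof. by rewrite !inE => /andP[]. Qed.

Lemma star_neighbours : [fset e in flow_edges F | v \in e]%fset = star v N.
Proof.
apply/fsetP => e; rewrite !inE; apply/andP/idP => [[eE]|/starP[x xN ->]]; last first.
  by rewrite neighbour_edge // fset21.
have [x [y [xV yV xy ee]]] := flow_edgesP eE.
rewrite ee in_fset2 => /orP[] /eqP vE; apply/starP.
  exists y; last by rewrite vE.
  by rewrite !inE yV /= vE -ee.
exists x; last by rewrite vE fsetUC.
by rewrite !inE xV /= vE fsetUC -ee.
Qed.

Lemma degree_neighbours : degree F v = #|` N|.
Proof.
rewrite /degree star_neighbours /star card_in_imfset //= => x y xN yN.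
have [_ _ vx] := edge_ends (neighbour_edge xN).
have [_ _ vy] := edge_ends (neighbour_edge yN).
by move=> /(fset2_eq vx vy)[[]//|[yv xv]]; rewrite xv.
Qed.

Hypothesis v_null : mup [set v] = 0%E /\ mum [set v] = 0%E.

(** The balance of the flow, evaluated on the singleton of v. *)
Lemma kirchhoff : \sum_(x <- N) m v x = 0.
Proof.
have mv := measurable_plane_set1 v.
have := flow_balance F mv; have [-> ->] := v_null; rewrite sube0.
have -> : (fun x y => (flow_mass F x y)%:E * (\d_y [set v] - \d_x [set v]))%E
    = (fun x y => (m x y * ((y == v)%:R - (x == v)%:R))%:E).
  apply/funext => x; apply/funext => y; rewrite !diracE EFinM EFinB.
  by rewrite !(_ : forall z, (z \in [set v]) = (z == v))// => z; apply/idP/eqP; rewrite inE.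
rewrite edge_sum_EFin => -[].
have sub : (star v N `<=` flow_edges F)%fset.
  by apply/fsubsetP => e /starP[x xN ->]; exact: neighbour_edge.
rewrite (edge_sum_diff _ sub) edge_sum_star; last 2 first.
- by apply/negP => /neighbour_edge/edge_ends[_ _]; rewrite eqxx.
- move=> x /neighbour_edge/flow_massC; rewrite -/m => /eqP; rewrite addr_eq0 => /eqP ->; ring.
rewrite /edge_sum big_seq big1 ?add0r => [|e]; last first.
  rewrite inE => /andP[eN eE]; have [x [y [xV yV xy ee]]] := flow_edgesP eE.
  have ve : v \notin e.
    by apply: contraNN eN => ve; rewrite -star_neighbours !inE eE.
  rewrite ee (edge_val_ext (g := fun _ _ => 0)) // => a b ae be.
  have av : a != v by apply: contraNneq ve => <-; rewrite ee.
  have bv : b != v by apply: contraNneq ve => <-; rewrite ee.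
  by rewrite (negbTE av) (negbTE bv) subrr mulr0.
rewrite big_seq (eq_bigr (fun x => - m v x)) => [|x xN].
  by rewrite -big_seq sumrN => /eqP; rewrite eq_sym oppr_eq0 => /eqP.
have [_ _ vx] := edge_ends (neighbour_edge xN).
by rewrite eqxx eq_sym (negbTE vx) sub0r mulrN1.
Qed.

Lemma degree_le3 : (degree F v <= 3)%N.
Proof.
rewrite degree_neighbours.
have -> : #|` N| = #|{: N}| by rewrite -cardfE.
pose z (i : N) : R * R := let x := val i in let c := `|m v x| `^ p / rho v x in
  (c * (x.1 - v.1), c * (x.2 - v.2)).
apply: (@balanced_star_card_le3 R _ p (fun i : N => m v (val i)) z) => //.
- by move=> i; apply: flow_mass_neq0; exact: neighbour_edge (valP i).
- by rewrite -[RHS]kirchhoff big_seq_fsetE.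
- move=> i; have [_ _ vx] := edge_ends (neighbour_edge (valP i)).
  have d0 := rho_gt0 vx.
  rewrite mulrC powRrM powR_mulrn ?powR_ge0// /z /=.
  transitivity ((`|m v (val i)| `^ p / rho v (val i)) ^+ 2 * rho v (val i) ^+ 2).
    by rewrite rho_sqr; ring.
  by field; rewrite gt_eqF.
(* the first variation in the direction of the resultant itself *)
- move=> D.
  pose I := [fset val i | i in D]%fset.
  have IE x : x \in I -> [fset v; x]%fset \in flow_edges F.
    by case/imfsetP => i _ ->; exact: neighbour_edge (valP i).
  have sumI (h : plane R -> R) : \sum_(x <- I) h x = \sum_(i in D) h (val i).
    rewrite big_imfset /= => [|i j _ _ /val_inj//].
    by rewrite big_enum.
  rewrite -(sumI (fun x => m v x)).
  set Z1 := \sum_(i in D) _; set Z2 := \sum_(i in D) (z i).2.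
  have [Z0|Z0] := eqVneq (Z1, Z2) 0.
    by case: Z0 => -> ->; rewrite expr0n addr0 powR_ge0.
  have lin n : \sum_(i in D) `|m v (val i)| `^ p * (dotp n (val i - v) / rho v (val i))
      = n.1 * Z1 + n.2 * Z2.
    by rewrite !mulr_sumr -big_split; apply: eq_bigr => i _; rewrite /z /dotp /=; ring.
  have := first_variation IE Z0; rewrite (sumI (fun x => `|m v x| `^ p * (dotp _ (x - v) / rho v x))) lin -[_ + _]/(dotp (Z1, Z2) (Z1, Z2)).
  set Q := dotp _ _; set A := _ `^ p => h.
  have Q0 : 0 <= Q by rewrite /Q /dotp /= addr_ge0 // -expr2 sqr_ge0.
  rewrite (mulrC 2) powRrM powR_mulrn ?powR_ge0// -/A.
  have A0 : 0 <= A by exact: powR_ge0.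
  have s0 := sqrtr_ge0 Q.
  have Es : Num.sqrt Q ^+ 2 = Q by rewrite sqr_sqrtr.
  move: h; rewrite -{1}Es -Es => h.
  have [->|sn] := eqVneq (Num.sqrt Q) 0; first by rewrite expr0n sqr_ge0.
  move: h; rewrite sqrtr_sqr ger0_norm // {1}expr2 ler_pM2r ?lt0r ?sn// => h.
  by rewrite ler_sqr.
Qed.

End optimal.

Lemma null_outside_supp (R : realType) (mu : {finite_measure set (plane R) -> \bar R}) v :
  ~ supp mu v -> mu [set v] = 0%E.
Proof.
move=> nv; apply: contrapT => mv; apply: nv => U oU Uv.
exists [set v]; split; [exact: measurable_plane_set1|by move=> x ->|exact/eqP].
Qed.

Theorem theorem2 (R : realType) (p : R) (hp0 : 0 < p) (hp1 : p < 1)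
  (mup mum : {finite_measure set (plane R) -> \bar R})
  (fin_mup : finite_set (supp mup)) (fin_mum : finite_set (supp mum))
  (eq_mass : mup setT = mum setT)
  (F : flow mup mum)
  (F_min : forall G : flow mup mum,
     gilbert (fun t => t `^ p) F <= gilbert (fun t => t `^ p) G)
  (v : plane R) (v_branching : branching_point F v) :
  ~ (4 <= degree F v)%N.
Proof.
have [vV nsupp] := v_branching; apply/negP; rewrite -leqNgt.
apply: (@degree_le3 R mup mum p) => //; first by rewrite hp0.
by split; apply: null_outside_supp => h; apply: nsupp; [left|right].
Qed.
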